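(* Let $d\ge 1$ and let $\mathcal{P}\in\mathscr{P}_d$ be a pencil of plane curves of degree $d$ that contains at worst two semistable curves $C_f$ and $C_g$, all other curves in $\mathcal{P}$ being stable (that is, $C_f\neq C_g$ are semistable members of $\mathcal{P}$ and every other member of $\mathcal{P}$ is stable). Then $\mathcal{P}$ is strictly semistable if and only if there exist a one-parameter subgroup $\lambda$ of $SL(3)$ and coordinates in $\mathbb{P}^2$ in which $\lambda$ is normalized, with weights $a_x,a_y,a_z$, such that $C_f$ and $C_g$ are both non-stable with respect to this $\lambda$, that is, $$\frac{\omega(f,\lambda)}{(a_x-a_z)+(a_y-a_z)}=\frac{d}{3}\qquad\text{and}\qquad\frac{\omega(g,\lambda)}{(a_x-a_z)+(a_y-a_z)}=\frac{d}{3}.$$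
   Context: The ground field is $\mathbb{C}$. Let $S_d$ be the vector space of homogeneous forms of degree $d$ in three variables. A plane curve of degree $d$ is $C_f=\{f=0\}\subset\mathbb{P}^2$ with $0\ne f\in S_d$ taken up to scalar, i.e. a point of $\mathbb{P}(S_d)$ (possibly non-reduced or reducible). A pencil of plane curves of degree $d$ is a two-dimensional subspace of $S_d$; its members (the curves in it) are the $C_f$ with $f$ a nonzero element of that subspace. The space of all such pencils is $\mathscr{P}_d=Gr(2,S_d)$, embedded by Plücker coordinates in $\mathbb{P}(\Lambda^2 S_d)$. Stability: $SL(3)$ acts on $S_d$ by linear changes of coordinates, hence on $\mathbb{P}(S_d)$, on $\Lambda^2S_d$ and on $\mathscr{P}_d\subset\mathbb{P}(\Lambda^2S_d)$. A point of a projective variety $X\subset\mathbb{P}(W)$ with linear $SL(3)$-action is semistable if, for a nonzero lift $\tilde{x}\in W$, $0\notin\overline{SL(3)\cdot\tilde{x}}$; it is stable if the orbit $SL(3)\cdot\tilde{x}$ is closed in $W$ and the stabilizer of $\tilde{x}$ is finite; it is strictly semistable if it is semistable but not stable. This is applied to curves ($X=\mathbb{P}(S_d)$) and to pencils ($X=\mathscr{P}_d$). A one-parameter subgroup is a non-trivial homomorphism $\lambda:\mathbb{C}^\times\to SL(3)$. It is normalized in coordinates $[x,y,z]$ of $\mathbb{P}^2$ if in these coordinates $\lambda(t)$ is the diagonal matrix $\mathrm{diag}(t^{a_x},t^{a_y},t^{a_z})$, scaling $x,y,z$ by $t^{a_x},t^{a_y},t^{a_z}$, with integers $a_x\ge a_y\ge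 a_z$, $a_x>0$, $a_x+a_y+a_z=0$. Writing $f=\sum f_{ij}x^iy^jz^{d-i-j}$ in such coordinates, the affine weight of $f$ at $\lambda$ is $\omega(f,\lambda)=\min\{(a_x-a_z)i+(a_y-a_z)j : f_{ij}\ne0\}$. *)

(* Defs.v *)
From HB Require Import structures.
From mathcomp Require Import all_boot all_order all_algebra.
From mathcomp Require Export reals classical_sets cardinality complex mpoly.

Set Implicit Arguments.
Unset Strict Implicit.
Unset Printing Implicit Defensive.

Import Order.TTheory GRing.Theory Num.Theory.
Import passmx.
Local Open Scope ring_scope.

(** * Zariski topology of a finite-dimensional vector space

    The orbit closures below are taken in this topology.  The choice of basis
    is immaterial: every basis gives the same polynomial functions. *)

Section Zariski.
Variables (K : fieldType) (W : vectType K).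

Definition polyfun (p : {mpoly K[\dim {:W}]}) (w : W) : K :=
  p.@[fun i => coord (vbasis {:W}) i w].

Definition zariski_closure (A : set W) : set W :=
  [set w | forall p : {mpoly K[\dim {:W}]},
     (forall a, A a -> polyfun p a = 0) -> polyfun p w = 0]%classic.

Definition zariski_closed (A : set W) : Prop := zariski_closure A = A.

End Zariski.

(** * Stability

    [act] is a linear action of SL(3) on [W]; its values at matrices of
    determinant other than 1 are ignored.  [w] is a nonzero lift of a point of
    P(W). *)

Section Stability.
Variables (K : fieldType) (W : vectType K) (act : 'M[K]_3 -> W -> W).

Definition orbit_SL3 (w : W) : set W :=
  [set act g w | g in [set g : 'M[K]_3 | \det g = 1]]%classic.

Definition stabilizer_SL3 (w : W) : set 'M[K]_3 :=
  [set g | \det g = 1 /\ act g w = w]%classic.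

Definition semistable (w : W) : Prop :=
  ~ zariski_closure (orbit_SL3 w) 0.

Definition stable (w : W) : Prop :=
  zariski_closed (orbit_SL3 w) /\ finite_set (stabilizer_SL3 w).

Definition strictly_semistable (w : W) : Prop :=
  semistable w /\ ~ stable w.

End Stability.

(** * Second exterior power

    In characteristic 0, [ext2 V] is the space of alternating tensors in
    V (x) V, written as skew-symmetric matrices in a fixed basis of V.  The
    (i, j) entry of [wedge u v] is the Plücker coordinate u_i v_j - v_i u_j. *)

Section ExteriorSquare.
Variables (K : numFieldType) (V : vectType K).
Let n := \dim {:V}.
Let e : n.-tuple V := vbasis {:V}.

Definition add_tr (X : 'M[K]_n) : 'M[K]_n := X + X^T.

Fact add_tr_is_linear : linear add_tr.
Proof. by move=> c X Y; rewrite /add_tr linearP scalerDr addrACA. Qed.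

HB.instance Definition _ :=
  GRing.isLinear.Build K 'M[K]_n 'M[K]_n _ add_tr add_tr_is_linear.

Definition skew_mx : {vspace 'M[K]_n} := lker (linfun add_tr).

Lemma skew_mxE (X : 'M[K]_n) : (X \in skew_mx) = (X^T == - X).
Proof. by rewrite memv_ker lfunE /= /add_tr addrC addr_eq0. Qed.

Definition ext2 : vectType K := subvs_of skew_mx.

Fact wedge_subproof (u v : V) :
  (rVof e u)^T *m rVof e v - (rVof e v)^T *m rVof e u \in skew_mx.
Proof. by rewrite skew_mxE linearB /= !trmx_mul !trmxK opprB. Qed.

Definition wedge (u v : V) : ext2 := Subvs (wedge_subproof u v).

Fact ext2_map_subproof (a : 'End(V)) (X : ext2) :
  (mxof e e a)^T *m vsval X *m mxof e e a \in skew_mx.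
Proof.
have := subvsP X; rewrite !skew_mxE => /eqP XT.
by rewrite !trmx_mul trmxK XT mulNmx mulmxN mulmxA.
Qed.

(* [mxof e e a] acts on row vectors from the right, so this is the restriction
   of a (x) a. *)
Definition ext2_map (a : 'End(V)) (X : ext2) : ext2 :=
  Subvs (ext2_map_subproof a X).

Lemma ext2_map_wedge (a : 'End(V)) (u v : V) :
  ext2_map a (wedge u v) = wedge (a u) (a v).
Proof.
have E w : rVof e (a w) = rVof e w *m mxof e e a.
  exact/rVof_app/vbasisP.
by apply: val_inj; rewrite /= !E mulmxBr mulmxBl !trmx_mul !mulmxA.
Qed.

End ExteriorSquare.

(** * Plane curves and pencils *)

Section Forms.
Variables (K : numFieldType) (d : nat).

(* The variables x, y, z are 'X_0, 'X_1, 'X_2. *)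
Definition ternary_form : vectType K := dhomog 3 K d.

Definition linear_forms (A : 'M[K]_3) : 3.-tuple {mpoly K[3]} :=
  [tuple \sum_(j < 3) A i j *: 'X_j | i < 3].

Fact lin_change_subproof (A : 'M[K]_3) (f : ternary_form) :
  (f : {mpoly K[3]}) \mPo linear_forms A \is d.-homog.
Proof.
rewrite comp_mpolyE big_seq; apply: rpred_sum => m mf; apply: rpredZ.
have lin i : tnth (linear_forms A) i \is 1.-homog.
  rewrite tnth_mktuple; apply: rpred_sum => j _; apply: rpredZ.
  by rewrite dhomogX /= mdeg1.
rewrite -(dhomog_mf (dhomog_is_dhomog f) mf) /= mdegE.
elim/big_ind2: _ => [|p1 k1 p2 k2|i _]; first exact: dhomog1.
- exact: dhomogM.
by move: (dhomogMn (m i) (lin i)); rewrite mul1n.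
Qed.

(* f o g^-1 on column vectors, for invertible g.  This is both the left action
   of g on forms and the expression of f in the coordinates p' = g p. *)
Definition lin_change (g : 'M[K]_3) (f : ternary_form) : ternary_form :=
  DHomog (lin_change_subproof (invmx g) f).

Fact lin_change_is_linear (g : 'M[K]_3) : linear (lin_change g).
Proof. by move=> c f1 f2; apply: val_inj; rewrite /= !linearP. Qed.

HB.instance Definition _ (g : 'M[K]_3) :=
  GRing.isLinear.Build K ternary_form ternary_form _ (lin_change g)
    (lin_change_is_linear g).

(* The curve C_f, as a point of P(S_d) for f <> 0. *)
Definition curve (f : ternary_form) : {vspace ternary_form} := <[f]>%VS.

Definition semistable_curve (f : ternary_form) : Prop :=
  semistable lin_change f.
Definition stable_curve (f : ternary_form) : Prop := stable lin_change f.

Definition pencil (P : {vspace ternary_form}) : Prop := \dim P = 2.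

(* The Plücker vector of P; another basis of P multiplies it by a nonzero
   scalar. *)
Definition plucker (P : {vspace ternary_form}) : ext2 ternary_form :=
  wedge (vbasis P)`_0 (vbasis P)`_1.

Definition ext2_change (g : 'M[K]_3) :
    ext2 ternary_form -> ext2 ternary_form :=
  ext2_map (linfun (lin_change g)).

Definition strictly_semistable_pencil (P : {vspace ternary_form}) : Prop :=
  strictly_semistable ext2_change (plucker P).

End Forms.

(** * One-parameter subgroups *)

Section OneParameterSubgroups.
Variable K : numFieldType.

(* A nontrivial homomorphism of algebraic groups from K^* to SL(3): the entries
   of lam t are Laurent polynomials in t.  The value at t = 0 is ignored. *)
Definition one_parameter_subgroup (lam : K -> 'M[K]_3) : Prop :=
  [/\ forall t, t != 0 -> \det (lam t) = 1,
      forall s t, s != 0 -> t != 0 -> lam (s * t) = lam s *m lam t,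
      exists2 t, t != 0 & lam t != 1%:M
    & exists (N : nat) (p : 'M[{poly K}]_3), forall t, t != 0 ->
        lam t = t ^- N *: \matrix_(i, j) (p i j).[t]].

(* lam is normalized in the coordinates p' = h p, with weights
   (a_x, a_y, a_z) = (a 0, a 1, a 2). *)
Definition normalized (lam : K -> 'M[K]_3) (h : 'M[K]_3) (a : 'I_3 -> int) :
    Prop :=
  [/\ a 2 <= a 1 <= a 0, 0 < a 0, a 0 + a 1 + a 2 = 0
    & forall t, t != 0 ->
        h *m lam t *m invmx h = diag_mx (\row_i t ^ a i)].

(* The weight of the monomial x^i y^j z^(d-i-j), with (i, j) = (m 0, m 1). *)
Definition monomial_weight (a : 'I_3 -> int) (m : 'X_{1..3}) : int :=
  (a 0 - a 2) * (m 0)%:Z + (a 1 - a 2) * (m 1)%:Z.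

(* A minimum over a nonempty support: F is nonzero, and is the expression of
   the form in the coordinates where the subgroup is diagonal. *)
Definition affine_weight (d : nat) (a : 'I_3 -> int) (F : ternary_form K d) :
    int :=
  let s := [seq monomial_weight a m | m <- msupp (F : {mpoly K[3]})] in
  \big[Order.min/head 0 s]_(w <- s) w.

(* C_f is non-stable with respect to the one-parameter subgroup with weights a
   in the coordinates p' = h p. *)
Definition nonstable_wrt (d : nat) (h : 'M[K]_3) (a : 'I_3 -> int)
    (f : ternary_form K d) : Prop :=
  (affine_weight a (lin_change h f))%:~R / ((a 0 - a 2) + (a 1 - a 2))%:~R
    = d%:R / 3 :> rat.

End OneParameterSubgroups.

(* Main.v *)
Require Import Defs.
From HB Require Import structures.
From mathcomp Require Import all_boot all_order all_algebra.
From mathcomp Require Import perm zify ring lra.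
From mathcomp Require Import boolp classical_sets.

Set Implicit Arguments.
Unset Strict Implicit.
Unset Printing Implicit Defensive.

Import Order.TTheory GRing.Theory Num.Theory.
Local Open Scope ring_scope.


(** Both sides of the equivalence fail for such a pencil.

    If [f] and [g] both have least weight 0 for one and the same one-parameter
    subgroup, then all weights of [f + g] are nonnegative.  Letting the
    parameter tend to 0 gives a form in the closure of the orbit of [f + g]
    that the subgroup fixes.  If [f + g] were stable, this limit would lie in
    its orbit and its stabilizer would be infinite ([not_stable]).  But
    [C_(f+g)] is a third member of the pencil, hence stable ([sum_stable]).

    On the other side, the Plücker vector of the pencil is stable
    ([plucker_stable]).  Suppose that it is not.  A valuative form of the
    Hilbert-Mumford criterion ([not_stable_pole]) gives a valuation ring of
    the field of rational functions in the entries of a matrix, with residue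
    field [K], for which the generic matrix [M] of determinant 1 is not
    integral although the Plücker coordinates of the pencil transformed by
    [M] are.  The valuation ring comes from Chevalley's extension theorem for
    places ([place_extension]), applied to the evaluation at a point of the
    orbit closure outside of the orbit, or at a point at infinity of the
    stabilizer.

    Write [M = k diag(a) l] with [k] and [l] invertible over the valuation
    ring ([smith]).  The factor [l] preserves integrality and can be dropped,
    and [k] reduces to a change of coordinates over [K].  Choose a basis
    [u, v] of the pencil over the valuation ring such that the coefficients
    of [v], multiplied by their monomials in [a], include one, [e], that
    divides all those of [u] and [v], and such that [u] vanishes at the
    monomial of [e].  The 2 x 2 minors that involve this monomial show that
    [e] times every coefficient of [u] is integral.  As the reduction of [u]
    is a semistable form, some coefficient of [u] has an integral inverse;
    hence [e], and then all the coefficients, are integral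
    ([pivot_integral], [dilation_integral]).

    So the monomials in [a] on the support of the reduction of [f + g] are
    integral.  These are finitely many homogeneous linear inequalities with
    integer coefficients on the valuations of the entries of [a]; since they
    have a nonzero solution in the value group, they have one in the integers
    ([torus_weights]).  It is a one-parameter subgroup that contradicts the
    stability of [f + g]. *)

(** * Extension of places *)
Section Subrings.
Variable B : comNzRingType.

Definition is_subring (S : set B) : Prop :=
  [/\ S 1, forall x y, S x -> S y -> S (x - y)
    & forall x y, S x -> S y -> S (x * y)].

(** Turns a subring given by a proposition into a structure on which the
    closure lemmas for sums and products apply. *)
Lemma subring_pred (S : set B) :
  is_subring S -> exists S' : subringClosed B, forall x, x \in S' <-> S x.
Proof.
case=> S1 SB SM; pose P : {pred B} := fun x => x \in S.
have cP : subring_closed P.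
  split=> [|x y /set_mem Sx /set_mem Sy|x y /set_mem Sx /set_mem Sy].
  - exact/mem_set.
  - exact/mem_set/SB.
  - exact/mem_set/SM.
pose S' : subringClosed B := HB.pack P (GRing.isSubringClosed.Build B P cP).
by exists S' => x; split=> [/set_mem|/mem_set].
Qed.

Definition adjoin (S : {pred B}) (z : B) : set B :=
  [set w | exists2 p : {poly B}, p \is a polyOver S & w = p.[z]]%classic.

Variables (S : subringClosed B) (z : B).

Lemma adjoin_subring : is_subring (adjoin S z).
Proof.
split; first by exists 1; rewrite ?rpred1 ?hornerC.
- by move=> _ _ [p Sp ->] [q Sq ->]; exists (p - q); rewrite ?rpredB ?hornerE.
- by move=> _ _ [p Sp ->] [q Sq ->]; exists (p * q); rewrite ?rpredM ?hornerM.
Qed.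

Lemma adjoin_base w : w \in S -> adjoin S z w.
Proof. by move=> Sw; exists w%:P; rewrite ?polyOverC ?hornerC. Qed.

Lemma adjoin_gen : adjoin S z z.
Proof. by exists 'X; rewrite ?polyOverX ?hornerX. Qed.

End Subrings.

Lemma pairM (A B : pzSemiRingType) (a c : A) (b d : B) :
  (a, b) * (c, d) = (a * c, b * d) :> A * B.
Proof. by []. Qed.

(** A ring morphism from a subring of [L] to [K] is handled through its graph,
    a subring of [L * K]: unions of chains, polynomial evaluation and closure
    under the operations then need no separate treatment of domain and values.
    The graph is functional as soon as it contains no [(0, y)] with [y]
    nonzero. *)
Section Chevalley.
Variables (K : closedFieldType) (L : fieldType) (iota : {rmorphism K -> L}).

Definition const_pair (a : K) : L * K := (iota a, a).

Fact const_pair_is_zmod_morphism : zmod_morphism const_pair.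
Proof. by move=> a b; rewrite /const_pair rmorphB. Qed.
Fact const_pair_is_monoid_morphism : monoid_morphism const_pair.
Proof. by split=> [|a b]; rewrite /const_pair ?rmorph1 ?rmorphM. Qed.
HB.instance Definition _ :=
  GRing.isZmodMorphism.Build K (L * K)%type const_pair const_pair_is_zmod_morphism.
HB.instance Definition _ :=
  GRing.isMonoidMorphism.Build K (L * K)%type const_pair
    const_pair_is_monoid_morphism.

Definition partial_morphism (S : {pred L * K}) : Prop :=
  (forall a, const_pair a \in S) /\ (forall y, (0, y) \in S -> y = 0).

(** The domain is a valuation ring whose residue field is [K]: an element
    outside of it has an inverse in the maximal ideal. *)
Definition place (S : {pred L * K}) : Prop :=
  partial_morphism S /\
  forall x, (exists y, (x, y) \in S) \/ (x^-1, 0) \in S.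

(** No [z] outside of [S] can be added: the graph generated by [S] and [z] is
    no longer functional. *)
Definition maximal_morphism (S : {pred L * K}) : Prop :=
  forall z : L * K,
    (forall p, p \is a polyOver S -> p.[z].1 = 0 -> p.[z].2 = 0) -> z \in S.

(** Zorn's lemma for graphs that contain [S0].  The empty set is admitted
    beside them because the empty chain has an empty union. *)
Lemma maximal_morphism_exists (S0 : subringClosed (L * K)%type) :
  partial_morphism S0 ->
  exists S : subringClosed (L * K)%type,
    [/\ {subset S0 <= S}, partial_morphism S & maximal_morphism S].
Proof.
move=> [S0d S0f].
pose good (A : set (L * K)) := [/\ is_subring A,
  (forall x, x \in S0 -> A x) & forall y, A (0, y) -> y = 0].
have gS0 : good [set` S0]%classic.
  split=> //; split=> /= [|x y|x y]; [exact: rpred1|exact: rpredB|exact: rpredM].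
have [F Fgood Ftot|A [+ Amax]] :=
  @Zorn_bigcup _ (fun A : set (L * K) => A = set0 \/ good A).
  have [[A FA A0]|noA] := pselect (exists2 A, F A & A !=set0)%classic; last first.
    left; rewrite -subset0 => x [A FA Ax].
    by case: noA; exists A => //; exists x.
  have gF X x : F X -> X x -> good X.
    by move=> FX Xx; case: (Fgood X FX) => // X0; rewrite X0 in Xx.
  have two x y : (\bigcup_(X in F) X)%classic x -> (\bigcup_(X in F) X)%classic y ->
      exists X, [/\ F X, good X, X x & X y].
    move=> [X FX Xx] [Y FY Yy].
    by case: (Ftot X Y FX FY) => [XY|YX]; [exists Y|exists X];
       split=> //; [exact: gF FY Yy|exact: XY|exact: gF FX Xx|exact: YX].
  have [a Aa] := A0; have [[A1 _ _] SA _] := gF _ _ FA Aa.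
  right; split; first split.
  - by exists A.
  - move=> x y /two /[apply] -[X [FX [[_ XB _] _ _] Xx Xy]].
    by exists X => //; exact: XB.
  - move=> x y /two /[apply] -[X [FX [[_ _ XM] _ _] Xx Xy]].
    by exists X => //; exact: XM.
  - by move=> x /SA Ax; exists A.
  - by move=> y [X FX Xy]; case: (gF _ _ FX Xy) => _ _; apply.
case=> [A0|[Asub AS0 Af]].
  case: (Amax [set` S0]%classic); last by right.
  rewrite A0; split; last by move=> /(_ 1); apply=> /=; exact: rpred1.
  exact: sub0set.
have [S SA] := subring_pred Asub.
exists S; split.
- by move=> x S0x; apply/SA/AS0.
- split=> [a|y /SA]; last exact: Af.
  exact/SA/AS0/S0d.
move=> z zf; apply: contrapT => Sz.
apply: (Amax (adjoin S z)).
  split=> [x /SA|]; first exact: adjoin_base.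
  by move=> /(_ z (adjoin_gen S z)) /SA.
right; split; first exact: adjoin_subring.
- by move=> x /AS0 /SA; exact: adjoin_base.
by move=> y [p Sp e]; have := zf p Sp; rewrite -e /=; apply.
Qed.

Lemma horner_fst (p : {poly L * K}) z : p.[z].1 = (map_poly fst p).[z.1].
Proof. by rewrite -horner_map. Qed.

Lemma horner_snd (p : {poly L * K}) z : p.[z].2 = (map_poly snd p).[z.2].
Proof. by rewrite -horner_map. Qed.

Section Maximal.
Variable S : subringClosed (L * K)%type.
Hypotheses (Sp : partial_morphism S) (Smax : maximal_morphism S).

(** The domain is a local ring: a relation satisfied by the inverse of [b]
    becomes, after multiplication by a power of [b], an equation in [S]. *)
Lemma maximal_morphism_unit b y :
  (b, y) \in S -> y != 0 -> (b^-1, y^-1) \in S.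
Proof.
move=> Sb y0; have b0 : b != 0.
  apply: contra_neq y0 => b0; rewrite b0 in Sb; exact: Sp.2.
have e : (b^-1, y^-1) * (b, y) = 1 :> L * K by rewrite pairM !mulVf.
apply: Smax => p /polyOverP pS p0.
have /Sp.2 : (0, p.[(b^-1, y^-1)].2 * y ^+ size p) \in S.
  have -> : (0, p.[(b^-1, y^-1)].2 * y ^+ size p) =
            p.[(b^-1, y^-1)] * (b, y) ^+ size p.
    rewrite [RHS]surjective_pairing.
    by rewrite !(rmorphM, rmorphXn) /= p0 mul0r.
  rewrite horner_coef big_distrl /=; apply: rpred_sum => i _.
  have -> : (b, y) ^+ size p = (b, y) ^+ i * (b, y) ^+ (size p - i).
    by rewrite -exprD subnKC // ltnW.
  rewrite mulrA -[_ * _ * _ ^+ i]mulrA -exprMn e expr1n mulr1.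
  by apply: rpredM; [exact: pS|exact: rpredX].
by move/eqP; rewrite mulf_eq0 expf_eq0 (negPf y0) andbF orbF => /eqP.
Qed.

Section Relations.
Variable x : L.

Definition relation_at (p : {poly L * K}) : Prop :=
  p \is a polyOver S /\ (map_poly fst p).[x] = 0.

Hypothesis xdom : ~ exists y, (x, y) \in S.
Hypothesis xinv : ~ (x^-1, 0) \in S.

Let x_neq0 : x != 0.
Proof. by apply/eqP => x0; case: xdom; exists 0; rewrite x0 rpred0. Qed.

(** [x] is integral over the domain.  Sending [x^-1] to 0 is impossible, which
    gives a relation on [x^-1] with invertible constant term; its reversal is
    a relation on [x] with invertible leading coefficient. *)
Lemma unit_leading_relation : exists n q,
  [/\ relation_at q, (size q <= n.+1)%N & (q`_n).2 != 0].
Proof.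
have [p [pS p1 p2]] : exists p : {poly L * K}, [/\ p \is a polyOver S,
    p.[(x^-1, 0)].1 = 0 & p.[(x^-1, 0)].2 != 0].
  apply: contrapT => nop; apply: xinv; apply: Smax => p pS p1.
  by apply: contrapT => /eqP p2; apply: nop; exists p.
(* [p`_n] is 0; the degree bound [n] spares the case [p = 0]. *)
pose n := size p; exists n, (\poly_(i < n.+1) p`_(n - i)).
have -> : (\poly_(i < n.+1) p`_(n - i))`_n = p.[(0, 0)].
  by rewrite coef_poly ltnSn subnn -horner_coef0.
split; last 1 first.
- by move: p2; rewrite !horner_snd.
- split; first by apply/polyOver_poly => i _; exact: (polyOverP pS).
  rewrite (@horner_coef_wide _ n.+1); last first.
    by rewrite (leq_trans (size_poly _ _)) ?size_poly.
  rewrite (reindex_inj rev_ord_inj) /=.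
  have n_ge : (size (map_poly fst p) <= n.+1)%N.
    by rewrite (leq_trans (size_poly _ _)).
  move: p1; rewrite horner_fst (horner_coef_wide _ n_ge) => p1.
  rewrite -[RHS](mulr0 (x ^+ n)) -[X in _ = _ * X]p1.
  rewrite big_distrr /=; apply: eq_bigr => i _.
  have i_le : (i <= n)%N by rewrite -ltnS.
  rewrite !coef_map /= coef_poly subSS ltnS leq_subr subKn // mulrCA; congr (_ * _).
  by rewrite exprVn expfB_cond // (negPf x_neq0) add0n.
exact: size_poly.
Qed.

Lemma no_common_root c : exists2 p, relation_at p & (map_poly snd p).[c] != 0.
Proof.
apply: contrapT => nop; apply: xdom; exists c; apply: Smax => p pS p1.
rewrite horner_fst in p1; rewrite horner_snd.
by apply: contrapT => /eqP p2; apply: nop; exists p.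
Qed.

(** The reductions of the relations on [x] form an ideal of [{poly K}] without
    a common root, and [K] is algebraically closed. *)
Lemma residue_one_relation :
  exists2 p, relation_at p & map_poly snd p = 1.
Proof.
pose J r := exists2 p, relation_at p & map_poly snd p = r.
have JM r s : J r -> J (s * r).
  move=> [p [pS p0] <-]; exists (map_poly const_pair s * p).
    split; last by rewrite rmorphM hornerM p0 mulr0.
    rewrite rpredM //; apply/polyOverP => i; rewrite coef_map; exact: Sp.1.
  rewrite rmorphM; congr (_ * _); by apply/polyP => i; rewrite !coef_map.
have JB r s : J r -> J s -> J (r - s).
  move=> [p [pS p0] <-] [q [qS q0] <-]; exists (p - q); last by rewrite rmorphB.
  by split; rewrite ?rpredB // rmorphB hornerD hornerN p0 q0 subr0.
(* A generator of the ideal. *)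
have [j Jj jmin] : exists2 j, J j /\ j != 0 &
    forall r, J r -> r != 0 -> (size j <= size r)%N.
  have [p0 p0r p0c] := no_common_root 0.
  have ex : exists n, `[< exists r, [/\ J r, r != 0 & size r = n] >].
    exists (size (map_poly snd p0)); apply/asboolP; exists (map_poly snd p0).
    split=> //; first by exists p0.
    by apply: contra_neq p0c => ->; rewrite horner0.
  case: (ex_minnP ex) => n /asboolP[j [Jj j0 <-]] jmin; exists j => // r Jr r0.
  by apply: jmin; apply/asboolP; exists r.
have [|j1] := boolP (size j == 1).
  move=> /size_poly1P[c c0 jc]; rewrite jc in Jj; have := JM _ c^-1%:P Jj.1.
  by rewrite -polyCM mulVf.
have [c /rootP jc] := closed_rootP _ j1; have [p pr pc] := no_common_root c.
set r := map_poly snd p in pc; have Jr : J r by exists p.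
have rj : r %% j != 0.
  apply: contra_neq pc => rj; rewrite [r](divp_eq r j) rj addr0.
  by rewrite hornerM jc mulr0.
have /jmin/(_ rj) : J (r %% j).
  have -> : r %% j = r - r %/ j * j by rewrite {2}(divp_eq r j) addrC addKr.
  by apply: JB => //; apply: JM; case: Jj.
by rewrite leqNgt ltn_modp Jj.2.
Qed.

(** Take a relation [q] of least degree [n] with invertible leading
    coefficient.  Division by [q] brings the degree of a relation [p] with
    reduction 1 below [n]; the constant term of [p] is invertible, so
    subtracting a multiple of [p] removes the constant term of [q], and
    dividing by [x] gives a relation of smaller degree than [q]. *)
Lemma relations_absurd : False.
Proof.
have [n0 [q0 q0P]] := unit_leading_relation.
have ex : exists n, `[< exists q,
    [/\ relation_at q, (size q <= n.+1)%N & (q`_n).2 != 0] >].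
  by exists n0; apply/asboolP; exists q0.
case: (ex_minnP ex) => n /asboolP[q [[qS qx] qn qu]] nmin.
have n_gt0 : (0 < n)%N.
  rewrite lt0n; apply/eqP => nz; rewrite nz in qn qu.
  have qc := size1_polyC qn.
  move: qx; rewrite qc map_polyC hornerC /= => q1.
  have /Sp.2/eqP : (0, (q`_0).2) \in S by rewrite -q1 -surjective_pairing (polyOverP qS).
  by rewrite (negPf qu).
have unitS w : w \in S -> w.2 != 0 -> exists2 v, v \in S & v * w = 1.
  case: w => b y bS y0; exists (b^-1, y^-1); first exact: maximal_morphism_unit.
  rewrite pairM !mulVf //; apply: contra_neq y0 => b0.
  by apply: Sp.2; rewrite -b0.
have [p [[pS px] pn p2]] : exists p,
    [/\ relation_at p, (size p <= n)%N & map_poly snd p = 1].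
  have [p] := residue_one_relation.
  have [m] := ubnP (size p); elim: m p => // m IHm p; rewrite ltnS => pm [pS px] p2.
  have [pn|pn] := leqP (size p) n; first by exists p.
  have [v vS vq] := unitS _ (polyOverP qS n) qu.
  pose k := (size p).-1; pose p' := p - (p`_k * v)%:P * 'X^(k - n) * q.
  have p'2 : map_poly snd p' = 1.
    rewrite rmorphB 2!rmorphM /= map_polyC /= -(coef_map snd) p2 coef1.
    by rewrite (_ : k == 0 = false) ?mul0r ?polyC0 ?mul0r ?subr0 //; lia.
  apply: (IHm p') => //; last first.
    split; last by rewrite rmorphB !rmorphM /= hornerD hornerN !hornerM px qx mulr0 subr0.
    by rewrite rpredB // !rpredM // ?polyOverC ?rpredM ?polyOverXn // (polyOverP pS).
  have sp : size p = k.+1 by rewrite prednK //; lia.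
  rewrite (leq_trans _ pm) // sp ltnS; apply/leq_sizeP => i ki.
  rewrite coefB -mulrA coefCM coefXnM ltnNge (leq_trans (leq_subr n k) ki) /=.
  have [->|i_k] := eqVneq i k.
    have nk : (n <= k)%N by rewrite -ltnS -sp.
    by rewrite (subKn nk) -mulrA vq mulr1 subrr.
  have ki' : (k < i)%N by rewrite ltn_neqAle eq_sym i_k.
  rewrite [p`_i]nth_default ?sp // [q`_(_)]nth_default ?mulr0 ?subr0 //.
  by rewrite (leq_trans qn) //; lia.
have [v vS vp] : exists2 v, v \in S & v * p`_0 = 1.
  apply: unitS; first exact: (polyOverP pS).
  by rewrite -coef_map p2 coefC eqxx oner_eq0.
pose q' := q - (q`_0 * v)%:P * p.
have q'0 : q'`_0 = 0 by rewrite coefB coefCM -mulrA vp mulr1 subrr.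
have q'n i : (n <= i)%N -> q'`_i = q`_i.
  by move=> ni; rewrite coefB coefCM [p`_i]nth_default ?mulr0 ?subr0 // (leq_trans pn).
have q'S : q' \is a polyOver S.
  by rewrite rpredB // rpredM // polyOverC rpredM // (polyOverP qS).
have q'x : (map_poly fst q').[x] = 0.
  by rewrite rmorphB rmorphM /= hornerD hornerN hornerM px qx mulr0 subr0.
pose q'' := drop_poly 1 q'.
have e : q' = q'' * 'X.
  by apply/polyP => -[|i]; rewrite coefMX /= ?q'0 // coef_drop_poly addn1.
suff : (n <= n.-1)%N by lia.
apply: nmin; apply/asboolP; exists q''; split; last 1 first.
- by rewrite coef_drop_poly addn1 prednK // q'n.
- split; first by apply/polyOverP => i; rewrite coef_drop_poly (polyOverP q'S).
  move: q'x; rewrite e rmorphM /= map_polyX hornerM hornerX => /eqP.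
  by rewrite mulf_eq0 (negPf x_neq0) orbF => /eqP.
rewrite prednK //; apply/leq_sizeP => i ni; rewrite coef_drop_poly q'n; last by lia.
by rewrite nth_default // (leq_trans qn) //; lia.
Qed.

End Relations.

Lemma maximal_morphism_place : place S.
Proof.
by split=> // x; apply: contrapT => /not_orP[]; exact: relations_absurd.
Qed.
End Maximal.

(** Chevalley's theorem: a [K]-morphism from a subring of [L] to the
    algebraically closed field [K] extends to a place. *)
Lemma place_extension (S0 : subringClosed (L * K)%type) :
  partial_morphism S0 ->
  exists2 S : subringClosed (L * K)%type, {subset S0 <= S} & place S.
Proof.
move=> /maximal_morphism_exists[S [S0S Sp Smax]].
by exists S => //; exact: maximal_morphism_place.
Qed.

End Chevalley.

(** * The generic matrix of determinant 1 *)
Section Generalities.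

Lemma rmorph_mmap n (A : nzRingType) (B C : comNzRingType) (f : {rmorphism B -> C})
    (h : A -> B) (v : 'I_n -> B) p :
  f (mmap h v p) = mmap (f \o h) (f \o v) p.
Proof.
rewrite /mmap rmorph_sum; apply: eq_bigr => m _; rewrite rmorphM; congr (_ * _).
by rewrite /mmap1 rmorph_prod; apply: eq_bigr => i _; rewrite rmorphXn.
Qed.

Lemma eq_mmap n (A B : nzRingType) (h1 h2 : A -> B) (v1 v2 : 'I_n -> B) p :
  h1 =1 h2 -> v1 =1 v2 -> mmap h1 v1 p = mmap h2 v2 p.
Proof.
move=> eh ev; rewrite /mmap; apply: eq_bigr => m _; rewrite eh; congr (_ * _).
exact: mmap1_eq.
Qed.

Lemma rpred_mmap n (A : nzRingType) (B : comNzRingType) (S : subringClosed B)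
    (h : A -> B) (v : 'I_n -> B) p :
  (forall a, h a \in S) -> (forall i, v i \in S) -> mmap h v p \in S.
Proof.
move=> hS vS; rewrite /mmap; apply: rpred_sum => m _; rewrite rpredM //.
by apply: rpred_prod => i _; rewrite rpredX.
Qed.

Lemma finite_mx (T : choiceType) m n (V : 'I_m -> 'I_n -> set T) :
  (forall i j, finite_set (V i j)) ->
  finite_set [set A : 'M[T]_(m, n) | forall i j, V i j (A i j)]%classic.
Proof.
move=> Vfin; have /boolp.choice[s sV] (ij : 'I_m * 'I_n) :
    exists s : seq T, V ij.1 ij.2 = [set` s]%classic.
  exact/finite_seqP/Vfin.
pose S := flatten [seq s ij | ij <- enum {: 'I_m * 'I_n}].
apply: (@sub_finite_set _ _ [set map_mx val B | B in [set: 'M[seq_sub S]_(m, n)]]%classic).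
  move=> A AV.
  have AS i j : A i j \in S.
    apply/flatten_mapP; exists (i, j); first by rewrite mem_enum.
    by have := AV i j; rewrite (sV (i, j)).
  by exists (\matrix_(i, j) SeqSub (AS i j)) => //; apply/matrixP => i j; rewrite !mxE.
exact/finite_image/finite_finset.
Qed.

End Generalities.

Section GenericMatrix.
Variables (K : closedFieldType) (n : nat).
Notation Kxx := {mpoly K[n.+1 * n.+1]}.

(** The entry [(i, j)] of [M] is substituted for the variable of index
    [mxvec_index i j]. *)
Definition mx_eval (B : comNzRingType) (h : K -> B) (M : 'M[B]_n.+1) (p : Kxx) : B :=
  mmap h (mxvec M 0) p.

Definition coord_mx : 'M[Kxx]_n.+1 := vec_mx (\row_k 'X_k).

HB.instance Definition _ (B : comNzRingType) (h : {rmorphism K -> B}) A :=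
  GRing.RMorphism.copy (mx_eval h A) (mmap h (mxvec A 0)).

Lemma mx_eval_coord (B : comNzRingType) (h : {rmorphism K -> B}) A i j :
  mx_eval h A (coord_mx i j) = A i j.
Proof. by rewrite /mx_eval mxE mxE mmapX mmap1U mxvecE. Qed.

Lemma mx_eval_det (B : comNzRingType) (h : {rmorphism K -> B}) A :
  mx_eval h A (\det coord_mx) = \det A.
Proof.
rewrite /mx_eval -det_map_mx; congr (\det _); apply/matrixP => i j.
by rewrite mxE; exact: mx_eval_coord.
Qed.

Lemma meval_coord A i j : (coord_mx i j).@[mxvec A 0] = A i j.
Proof. exact: (mx_eval_coord idfun). Qed.

Lemma meval_det A : (\det coord_mx).@[mxvec A 0] = \det A.
Proof. exact: (mx_eval_det idfun). Qed.

(** Evaluating over [L * K] does so over [L] and [K] at the same time. *)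
Section PairEvaluation.
Variables (L : fieldType) (iota : {rmorphism K -> L}).

Definition pair_mx (M : 'M[L]_n.+1) (A : 'M[K]_n.+1) : 'M[L * K]_n.+1 :=
  \matrix_(i, j) (M i j, A i j).

Lemma mx_eval_pair M A p :
  mx_eval (const_pair iota) (pair_mx M A) p =
  (mx_eval iota M p, p.@[mxvec A 0]).
Proof.
rewrite [LHS]surjective_pairing /mx_eval !rmorph_mmap /=; congr (_, _).
  apply: eq_mmap => // k; case/mxvec_indexP: k => i j /=.
  by rewrite !mxvecE mxE.
rewrite /meval; apply: eq_mmap => // k; case/mxvec_indexP: k => i j /=.
by rewrite !mxvecE mxE.
Qed.

Lemma pair_mx_eval (S : subringClosed (L * K)%type)
    (M : 'M[L]_n.+1) (A : 'M[K]_n.+1) p :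
  (forall a, const_pair iota a \in S) -> (forall i j, (M i j, A i j) \in S) ->
  (mx_eval iota M p, p.@[mxvec A 0]) \in S.
Proof.
move=> Sd SM; rewrite -mx_eval_pair; apply: rpred_mmap => // k.
by case/mxvec_indexP: k => i j; rewrite mxvecE mxE.
Qed.

End PairEvaluation.

Notation L := {fraction Kxx}.
Local Notation frac := (@tofrac Kxx).

Definition const_frac (a : K) : L := frac a%:MP.
HB.instance Definition _ := GRing.RMorphism.copy const_frac (@tofrac Kxx \o @mpolyC _ K).

(** The matrix of indeterminates with its first row divided by the
    determinant: its entries lie in the fraction field of a polynomial ring,
    and every matrix of determinant 1 is a specialization of it. *)
Definition generic_mx : 'M[L]_n.+1 :=
  \matrix_(i, j) (if i == 0 then (frac (\det coord_mx))^-1 * frac (coord_mx i j)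
                  else frac (coord_mx i j)).

(** The graph of the evaluation at [A] on the rational functions regular
    at [A]. *)
Definition local_ring (A : 'M[K]_n.+1) : set (L * K) :=
  [set w | exists p q : Kxx, q.@[mxvec A 0] != 0 /\
     w = (frac p / frac q, p.@[mxvec A 0] / q.@[mxvec A 0])]%classic.

Lemma local_ring_subring A : is_subring (local_ring A).
Proof.
have nz q : q.@[mxvec A 0] != 0 -> frac q != 0 :> L.
  by rewrite tofrac_eq0; apply: contra_neq => ->; rewrite meval0.
split=> [|w1 w2 [p1 [q1 [n1 ->]]] [p2 [q2 [n2 ->]]]|w1 w2 [p1 [q1 [n1 ->]]] [p2 [q2 [n2 ->]]]].
- by exists 1, 1; rewrite meval1 oner_neq0 tofrac1 !divr1.
- exists (p1 * q2 + (- p2) * q1), (q1 * q2).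
  split; first by rewrite mevalM mulf_neq0.
  rewrite tofracD !tofracM tofracN mevalD !mevalM mevalN -!addf_div ?nz //.
  by rewrite !mulNr.
- exists (p1 * p2), (q1 * q2); split; first by rewrite mevalM mulf_neq0.
  by rewrite !tofracM !mevalM pairM !mulf_div.
Qed.

Lemma local_ring_base A p : local_ring A (frac p, p.@[mxvec A 0]).
Proof. by exists p, 1; rewrite meval1 oner_neq0 tofrac1 !divr1. Qed.

Lemma local_ringV A p : p.@[mxvec A 0] != 0 ->
  local_ring A ((frac p)^-1, (p.@[mxvec A 0])^-1).
Proof. by move=> p0; exists 1, p; rewrite meval1 tofrac1 !div1r. Qed.

Lemma local_ring_fun A y : local_ring A (0, y) -> y = 0.
Proof.
move=> [p [q [q0 [/esym/eqP pq ->]]]].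
have q1 : frac q != 0 :> L.
  by rewrite tofrac_eq0; apply: contra_neq q0 => ->; rewrite meval0.
move: pq; rewrite mulf_eq0 invr_eq0 (negPf q1) orbF tofrac_eq0 => /eqP ->.
by rewrite meval0 mul0r.
Qed.

Lemma det_generic_mx : \det generic_mx = 1.
Proof.
have d0 : frac (\det coord_mx) != 0 :> L.
  rewrite tofrac_eq0; apply/eqP => d0; have := meval_det 1%:M.
  by rewrite d0 meval0 det1 => /esym/eqP; rewrite oner_eq0.
have -> : generic_mx = diag_mx (\row_i if i == 0 then (frac (\det coord_mx))^-1
    else 1) *m map_mx (@tofrac Kxx) coord_mx.
  rewrite mul_diag_mx; apply/matrixP => i j; rewrite !mxE.
  by case: eqP; rewrite ?mul1r.
rewrite det_mulmx det_diag det_map_mx big_ord_recl !mxE /= big1 => [|i _].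
  by rewrite mulr1 mulVf.
by rewrite mxE.
Qed.

Lemma generic_mx_local A i j : \det A = 1 -> local_ring A (generic_mx i j, A i j).
Proof.
move=> dA; have [_ _ LM] := local_ring_subring A.
have base := local_ring_base A (coord_mx i j); rewrite meval_coord in base.
rewrite mxE; case: eqP => // _.
rewrite -[A i j]mul1r -[1]invr1 -pairM; apply: LM => //.
by have := @local_ringV A (\det coord_mx); rewrite meval_det dA oner_neq0; apply.
Qed.

Lemma generic_mx_eval A p : \det A = 1 ->
  local_ring A (mx_eval const_frac generic_mx p, p.@[mxvec A 0]).
Proof.
move=> dA; have [S SE] := subring_pred (local_ring_subring A).
apply/SE; apply: pair_mx_eval => [a|i j]; apply/SE; last exact: generic_mx_local.
by have := local_ring_base A a%:MP; rewrite mevalC.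
Qed.

(** [generic_mx] is a generic point of the matrices of determinant 1. *)
Lemma generic_mx_eval0 A p : \det A = 1 ->
  mx_eval const_frac generic_mx p = 0 -> p.@[mxvec A 0] = 0.
Proof. by move=> /(generic_mx_eval p) + p0; rewrite p0 => /local_ring_fun. Qed.

End GenericMatrix.

(** * Linear algebra over a valuation ring *)
Section Places.
Variables (K : closedFieldType) (L : fieldType) (iota : {rmorphism K -> L}).
Variable S : subringClosed (L * K)%type.
Hypothesis Sp : place iota S.

Definition integral : {pred L} := fun x => `[< exists y, (x, y) \in S >].

Lemma integralP x : reflect (exists y, (x, y) \in S) (x \in integral).
Proof. exact: asboolP. Qed.

Fact integral_subring_closed : subring_closed integral.
Proof.
split=> [|x1 x2 /integralP[y1 S1] /integralP[y2 S2]|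
  x1 x2 /integralP[y1 S1] /integralP[y2 S2]]; apply/integralP.
- by exists 1; exact: (rpred1 S).
- by exists (y1 - y2); exact: (rpredB S1 S2).
- by exists (y1 * y2); exact: (rpredM S1 S2).
Qed.
HB.instance Definition _ :=
  GRing.isSubringClosed.Build L integral integral_subring_closed.

Lemma residue_uniq x y z : (x, y) \in S -> (x, z) \in S -> y = z.
Proof.
move=> xy xz; apply/subr0_eq; apply: Sp.1.2.
have -> : (0, y - z) = (x, y) - (x, z) :> L * K by congr (_, _); rewrite subrr.
exact: rpredB.
Qed.

Lemma integral_iota a : iota a \in integral.
Proof. by apply/integralP; exists a; exact: Sp.1.1. Qed.

Lemma nonintegralV x : x \notin integral -> (x^-1, 0) \in S.
Proof. by case: (Sp.2 x) => // /integralP ->. Qed.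

Lemma integral_or_inv x : (x \in integral) || (x^-1 \in integral).
Proof.
have [//|/nonintegralV xV] := boolP (x \in integral).
by apply/integralP; exists 0.
Qed.

Lemma residue_neq0V x y : (x, y) \in S -> y != 0 -> (x^-1, y^-1) \in S.
Proof.
move=> xy y0; have [xi|/nonintegralV] := boolP (x^-1 \in integral).
  have [z xz] := integralP _ xi.
  have x0 : x != 0 by apply: contra_neq y0 => x0; apply: Sp.1.2; rewrite -x0.
  have := rpredM xy xz; rewrite pairM divff // => /residue_uniq /(_ (rpred1 S)) yz.
  by rewrite -[y^-1]mulr1 -yz mulKf.
rewrite invrK => x0; by rewrite (residue_uniq xy x0) eqxx in y0.
Qed.

Definition max_ideal : {pred L} := fun x => (x, 0) \in S.

Lemma max_idealE x : (x \in max_ideal) = ((x, 0) \in S).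
Proof. by []. Qed.

Lemma max_idealN x : x \notin max_ideal -> x^-1 \in integral.
Proof.
move=> xm; have [/integralP[y xy]|/nonintegralV xV] := boolP (x \in integral).
  have y0 : y != 0 by apply: contra xm => /eqP y0; rewrite max_idealE -y0.
  by apply/integralP; exists y^-1; exact: residue_neq0V.
by apply/integralP; exists 0.
Qed.

Lemma max_ideal_inv x : x != 0 -> (x \in max_ideal) = (x^-1 \notin integral).
Proof.
move=> x0; apply/idP/idP => [xm|/nonintegralV]; last by rewrite invrK.
apply/negP => /integralP[y xy]; have := rpredM (xm : (x, 0) \in S) xy.
by rewrite pairM divff // mul0r => /residue_uniq /(_ (rpred1 S))/esym/eqP; rewrite oner_eq0.
Qed.

(** Divisibility in a valuation ring is a total preorder. *)
Lemma common_divisor (I : eqType) (s : seq I) (F : I -> L) :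
  s != [::] -> exists2 i, i \in s & forall j, j \in s ->
    exists2 o, o \in integral & F j = o * F i.
Proof.
elim: s => // i s IHs _; have [->|/IHs[k ks kP]] := eqVneq s [::].
  exists i; rewrite ?mem_head // => j; rewrite inE => /eqP ->.
  by exists 1; rewrite ?rpred1 ?mul1r.
have div x y : (exists2 o, o \in integral & x = o * y) \/
    (exists2 o, o \in integral & y = o * x).
  have [->|x0] := eqVneq x 0; first by left; exists 0; rewrite ?rpred0 ?mul0r.
  have [->|y0] := eqVneq y 0; first by right; exists 0; rewrite ?rpred0 ?mul0r.
  have [xy|xy] := orP (integral_or_inv (x / y)); [left|right].
    by exists (x / y) => //; rewrite divfK.
  by exists (y / x); rewrite ?divfK // -invf_div.
have [[o oi oE]|[o oi oE]] := div (F i) (F k).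
  exists k; rewrite ?in_cons ?ks ?orbT // => j; rewrite in_cons => /predU1P[->|/kP//].
  by exists o.
exists i; rewrite ?mem_head // => j; rewrite in_cons => /predU1P[->|/kP[o' oi' ->]].
  by exists 1; rewrite ?rpred1 ?mul1r.
by exists (o' * o); rewrite ?rpredM // oE mulrA.
Qed.

Definition integral_mx m n (A : 'M[L]_(m, n)) := forall i j, A i j \in integral.

Lemma integral_mxM m n p (A : 'M[L]_(m, n)) (B : 'M_(n, p)) :
  integral_mx A -> integral_mx B -> integral_mx (A *m B).
Proof. by move=> Ai Bi i j; rewrite mxE rpred_sum // => k _; rewrite rpredM. Qed.

Definition integral_unitmx n (A : 'M[L]_n) :=
  exists2 B, integral_mx A /\ integral_mx B & A *m B = 1%:M.

Lemma integral_unitmxM n (A B : 'M[L]_n) :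
  integral_unitmx A -> integral_unitmx B -> integral_unitmx (A *m B).
Proof.
move=> [A' [Ai Ai'] AA] [B' [Bi Bi'] BB]; exists (B' *m A').
  by split; exact: integral_mxM.
by rewrite mulmxA -[A *m B *m B']mulmxA BB mulmx1 AA.
Qed.

Lemma integral_block m1 m2 n1 n2 (A : 'M[L]_(m1, n1)) (B : 'M_(m1, n2))
    (C : 'M_(m2, n1)) (D : 'M_(m2, n2)) :
  integral_mx A -> integral_mx B -> integral_mx C -> integral_mx D ->
  integral_mx (block_mx A B C D).
Proof.
by move=> Ai Bi Ci Di i j; rewrite mxE; case: split => k; rewrite mxE; case: split.
Qed.

Lemma integral_mx0 m n : integral_mx (0 : 'M[L]_(m, n)).
Proof. by move=> i j; rewrite mxE rpred0. Qed.

Lemma integral_mx1 n : integral_mx (1%:M : 'M[L]_n).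
Proof. by move=> i j; rewrite mxE rpredMn ?rpred1. Qed.

Lemma integral_mxN m n (A : 'M[L]_(m, n)) : integral_mx A -> integral_mx (- A).
Proof. by move=> Ai i j; rewrite mxE rpredN. Qed.

Lemma integral_tperm_mx n (i j : 'I_n) : integral_unitmx (tperm_mx i j : 'M[L]_n).
Proof.
have int : integral_mx (tperm_mx i j : 'M[L]_n).
  by move=> k l; rewrite !mxE rpredMn ?rpred1.
by exists (tperm_mx i j) => //; rewrite -perm_mxM tperm2 perm_mx1.
Qed.

(** Move an entry that divides all the others to the corner and clear its row
    and column; the multipliers are integral by the choice of the pivot. *)
Lemma smith n (A : 'M[L]_n) : exists k l (a : 'rV[L]_n),
  [/\ integral_unitmx k, integral_unitmx l & A = k *m diag_mx a *m l].
Proof.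
elim: n A => [|n IHn] A.
  have u : integral_unitmx (1%:M : 'M[L]_0).
    by exists 1%:M; rewrite ?mulmx1 //; split; exact: integral_mx1.
  by exists 1%:M, 1%:M, 0; split=> //; apply/matrixP; case.
have [[i0 j0] _ ijP] : exists2 ij, ij \in enum {: 'I_n.+1 * 'I_n.+1} &
    forall kl, kl \in enum {: 'I_n.+1 * 'I_n.+1} ->
    exists2 o, o \in integral & A kl.1 kl.2 = o * A ij.1 ij.2.
  apply: (common_divisor (fun ij => A ij.1 ij.2)).
  by rewrite -size_eq0 -cardE card_prod card_ord.
pose A' : 'M[L]_(1 + n) := xcol j0 ord0 (xrow i0 ord0 A); set e := A i0 j0 in ijP.
have e00 : ulsubmx A' = e%:M.
  have l0 : lshift n 0 = ord0 :> 'I_(1 + n).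
    by apply: (@ord_inj (1 + n)).
  by apply/matrixP => i j; rewrite !ord1 !mxE l0 !tpermR mulr1n.
have /boolp.choice[q qP] (ij : 'I_(1 + n) * 'I_(1 + n)) :
    exists o, o \in integral /\ A' ij.1 ij.2 = e * o.
  have [|o oi oE] := ijP (tperm i0 ord0 ij.1, tperm j0 ord0 ij.2); first by rewrite mem_enum.
  by exists o; rewrite mulrC !mxE.
pose r : 'rV[L]_n := \row_j q (lshift n 0, rshift 1 j).
pose c : 'cV[L]_n := \col_i q (rshift 1 i, lshift n 0).
have ri : integral_mx r by move=> i j; rewrite mxE; exact: (qP (_, _)).1.
have ci : integral_mx c by move=> i j; rewrite mxE; exact: (qP (_, _)).1.
have rE : ursubmx A' = e *: r.
  by apply/matrixP => i j; rewrite ord1 [RHS]mxE [r _ _]mxE -(qP (_, _)).2 !mxE.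
have cE : dlsubmx A' = e *: c.
  by apply/matrixP => i j; rewrite ord1 [RHS]mxE [c _ _]mxE -(qP (_, _)).2 !mxE.
have [k [l [a [ku lu aE]]]] := IHn (drsubmx A' - e *: (c *m r)).
have lower : integral_unitmx (block_mx 1%:M 0 c 1%:M : 'M[L]_(1 + n)).
  exists (block_mx 1%:M 0 (- c) 1%:M).
    by split; apply: integral_block;
      do ?[exact: integral_mx1|exact: integral_mx0|exact: integral_mxN].
  by rewrite mulmx_block !mul0mx !mulmx0 !mulmx1 !mul1mx !addr0 add0r subrr -scalar_mx_block.
have upper : integral_unitmx (block_mx 1%:M r 0 1%:M : 'M[L]_(1 + n)).
  exists (block_mx 1%:M (- r) 0 1%:M).
    by split; apply: integral_block;
      do ?[exact: integral_mx1|exact: integral_mx0|exact: integral_mxN].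
  by rewrite mulmx_block !mul0mx !mulmx0 !mulmx1 !mul1mx !addr0 !add0r addNr -scalar_mx_block.
have block u : integral_unitmx u -> integral_unitmx (block_mx 1%:M 0 0 u : 'M[L]_(1 + n)).
  move=> [v [ui vi] uv]; exists (block_mx 1%:M 0 0 v).
    by split; apply: integral_block; do ?[exact: integral_mx1|exact: integral_mx0|].
  by rewrite mulmx_block !mul0mx !mulmx0 !mulmx1 uv !addr0 !add0r -scalar_mx_block.
pose k' : 'M[L]_(1 + n) := block_mx 1%:M 0 c 1%:M *m block_mx 1%:M 0 0 k.
pose l' : 'M[L]_(1 + n) := block_mx 1%:M 0 0 l *m block_mx 1%:M r 0 1%:M.
have A'E : A' = k' *m diag_mx (row_mx e%:M a) *m l'.
  have -> : diag_mx (row_mx e%:M a) = block_mx e%:M 0 0 (diag_mx a) :> 'M[L]_(1 + n).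
    by rewrite diag_mx_row; congr block_mx; apply/matrixP => i j; rewrite !ord1 !mxE.
  rewrite /k' /l' !mulmx_block !mul0mx !mulmx0 !mul1mx !mulmx1 !addr0 !add0r -aE.
  rewrite !mulmx0 !mul0mx !mulmx1 !mul1mx !addr0 mul_scalar_mx mul_mx_scalar -scalemxAl.
  rewrite [X in block_mx _ _ _ X]addrC subrK.
  by rewrite -e00 -rE -cE submxK.
exists (tperm_mx i0 ord0 *m k'), (l' *m tperm_mx j0 ord0), (row_mx e%:M a); split.
- apply: integral_unitmxM; first exact: integral_tperm_mx.
  by apply: integral_unitmxM; [|exact: block].
- apply: integral_unitmxM; last exact: integral_tperm_mx.
  by apply: integral_unitmxM; [exact: block|].
have -> : A = tperm_mx i0 ord0 *m A' *m tperm_mx j0 ord0.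
  rewrite /A' xcolE xrowE !mulmxA -perm_mxM tperm2 perm_mx1 mul1mx.
  by rewrite -mulmxA -perm_mxM tperm2 perm_mx1 mulmx1.
by rewrite A'E !mulmxA.
Qed.
End Places.

(** * Hilbert-Mumford criterion, valuative form *)
Lemma finite_roots (K : closedFieldType) (p : {poly K}) :
  p != 0 -> finite_set [set x | root p x]%classic.
Proof.
move=> p0; have [r pE] := closed_field_poly_normal p.
apply/finite_seqP; exists r; apply/seteqP; split=> x /=.
  by rewrite pE rootZ ?root_prod_XsubC // lead_coef_eq0.
by rewrite pE rootZ ?root_prod_XsubC // lead_coef_eq0.
Qed.

Section ValuativeCriterion.
Variables (K : closedFieldType) (W : vectType K) (act : 'M[K]_3 -> W -> W) (w0 : W).

Notation Kxx := {mpoly K[3 * 3]}.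
Notation L := {fraction Kxx}.
Notation iota := (@const_frac K 2).
Notation M := (generic_mx K 2).

(** [N] is the polynomial function [psi] of the point [act g w0], as a function
    of [g^-1]; forms are transformed through the inverse matrix. *)
Definition pulls_back (psi : {mpoly K[\dim {:W}]}) (N : Kxx) : Prop :=
  forall A, \det A = 1 -> N.@[mxvec A 0] = polyfun psi (act (invmx A) w0).

(** The evaluation at [w] of polynomial functions on the orbit of [w0], these
    functions being seen as rational functions of a matrix. *)
Definition limit_graph (w : W) : set (L * K) :=
  [set x | exists psi N, pulls_back psi N /\
     x = (mx_eval iota M N, polyfun psi w)]%classic.

Lemma limit_graph_subring w : is_subring (limit_graph w).
Proof.
split=> [|_ _ [p1 [N1 [E1 ->]]] [p2 [N2 [E2 ->]]]|_ _ [p1 [N1 [E1 ->]]] [p2 [N2 [E2 ->]]]].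
- exists 1, 1; split; first by move=> A _; rewrite /polyfun !meval1.
  by rewrite /polyfun meval1 /mx_eval rmorph1.
- exists (p1 - p2), (N1 - N2); split=> [A dA|]; last by rewrite /polyfun mevalB /mx_eval rmorphB.
  by rewrite /polyfun !mevalB E1 // E2.
- exists (p1 * p2), (N1 * N2); split=> [A dA|]; last by rewrite /polyfun mevalM /mx_eval rmorphM.
  by rewrite /polyfun !mevalM E1 // E2.
Qed.

Lemma limit_graph_const w a : limit_graph w (const_pair iota a).
Proof.
exists a%:MP, a%:MP; split; first by move=> A _; rewrite /polyfun !mevalC.
by rewrite /polyfun mevalC /mx_eval mmapC.
Qed.

(** Evaluation at [w] is well defined because polynomials that vanish
    on the orbit vanish at [w]. *)
Lemma limit_graph_fun w y :
  zariski_closure (orbit_SL3 act w0) w -> limit_graph w (0, y) -> y = 0.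
Proof.
move=> cl [psi [N [E [/esym N0 ->]]]]; apply: cl => _ [g dg <-].
rewrite -[g]invmxK -E; last by rewrite det_inv dg invr1.
by apply: generic_mx_eval0; rewrite // det_inv dg invr1.
Qed.

Hypothesis act_regular : forall i, exists N, pulls_back 'X_i N.

(** The orbit map has a pole at [S]: the generic group element tends to
    infinity along [S] while the point of the orbit stays bounded. *)
Definition pole_of_orbit (S : subringClosed (L * K)%type) : Prop :=
  [/\ place iota S, ~ integral_mx S M
    & forall psi N, pulls_back psi N -> mx_eval iota M N \in integral S].

(** Extend the evaluation at [w] to a place.  If the generic matrix were
    integral, its reduction would be a group element that sends [w0]
    to [w]. *)
Lemma pole_of_boundary w :
  zariski_closure (orbit_SL3 act w0) w -> ~ orbit_SL3 act w0 w ->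
  exists S : subringClosed (L * K)%type, pole_of_orbit S.
Proof.
move=> cl worb; have [S0 S0E] := subring_pred (limit_graph_subring w).
have S0p : partial_morphism iota S0.
  split=> [a|y /S0E]; last exact: limit_graph_fun.
  exact/S0E/limit_graph_const.
have [S S0S Sp] := place_extension S0p; exists S; split=> // [|psi N E]; last first.
  by apply/integralP; exists (polyfun psi w); apply/S0S/S0E; exists psi, N.
move=> Mint; apply: worb.
have /boolp.choice[a aS] (ij : 'I_3 * 'I_3) : exists y, (M ij.1 ij.2, y) \in S.
  exact/(integralP S)/Mint.
pose A : 'M[K]_3 := \matrix_(i, j) a (i, j).
have NS N : (mx_eval iota M N, N.@[mxvec A 0]) \in S.
  apply: pair_mx_eval => [c|i j]; first exact: Sp.1.1.
  by rewrite [A i j]mxE; exact: (aS (i, j)).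
have dA : \det A = 1.
  apply: (residue_uniq Sp (x := 1)); last exact: (rpred1 S).
  have := NS (\det (coord_mx K 2)).
  by rewrite meval_det mx_eval_det det_generic_mx.
exists (invmx A); first by rewrite /= det_inv dA invr1.
rewrite (coord_vbasis (memvf w)) [LHS](coord_vbasis (memvf _)).
apply: eq_bigr => i _; congr (_ *: _); have [N NE] := act_regular i.
have := NE A dA; rewrite /polyfun mevalXU => <-; apply: (residue_uniq Sp (NS N)).
apply/S0S/S0E; exists 'X_i, N; split=> //.
by rewrite /polyfun mevalXU.
Qed.

(** Some matrix entry [y] takes infinitely many values on the stabilizer, and
    the evaluation at [w0] extends to [y^-1] with value 0.  For consider a
    relation of degree [n] on [y^-1] whose coefficients are functions on the
    orbit.  Multiplied by [y^n] and specialized at the elements of the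
    stabilizer, where these functions have their value at [w0], it becomes a
    polynomial over [K] with infinitely many roots.  So all its coefficients
    vanish, among them the value at [w0] of the constant term of the
    relation. *)
Lemma pole_of_infinite_stabilizer :
  infinite_set (stabilizer_SL3 act w0) ->
  exists S : subringClosed (L * K)%type, pole_of_orbit S.
Proof.
move=> Hinf.
pose V i j := [set invmx h i j | h in stabilizer_SL3 act w0]%classic.
have [i [j Vinf]] : exists i j, infinite_set (V i j).
  apply: contrapT => nV; apply: Hinf.
  have /(finite_image invmx) : finite_set
      [set A : 'M[K]_3 | forall i j, V i j (A i j)]%classic.
    apply: finite_mx => i j; apply: contrapT => Vij; apply: nV; by exists i, j.
  apply: sub_finite_set => h Hh; exists (invmx h); last exact: invmxK.
  by move=> i j; exists h.
have cl0 : zariski_closure (orbit_SL3 act w0) w0.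
  have [h [dh hw]] : (stabilizer_SL3 act w0 !=set0)%classic.
    by apply: contrapT => /set0P/negP/negPn/eqP H0; apply: Hinf; rewrite H0.
  by move=> p; apply; exists h.
have [S0 S0E] := subring_pred (limit_graph_subring w0).
have S0c a : const_pair iota a \in S0 by exact/S0E/limit_graph_const.
set y := M i j.
have locV h : stabilizer_SL3 act w0 h ->
    local_ring (invmx h) (y, invmx h i j).
  by move=> [dh _]; apply: generic_mx_local; rewrite det_inv dh invr1.
have y0 : y != 0.
  apply: contra_notN Vinf => /eqP y0; apply: (sub_finite_set _ (finite_set1 0)).
  by move=> _ [h /locV + <-]; rewrite y0 => /local_ring_fun.
have [S1 S1E] := subring_pred (adjoin_subring S0 (y^-1, 0)).
have S1p : partial_morphism iota S1.
  split=> [a|c /S1E[p pS pc]]; first by apply/S1E/adjoin_base.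
  pose n := size p.
  have p1 : \sum_(k < n.+1) (p`_k).1 * y ^- k = 0.
    have /(congr1 fst)/esym := pc; rewrite horner_fst (@horner_coef_wide _ n.+1) /=.
      move=> p1; rewrite -[RHS]p1; apply: eq_bigr => k _.
      by rewrite coef_map exprVn.
    exact: leq_trans (size_poly _ _) _.
  have -> : c = (p`_0).2.
    by have /(congr1 snd) := pc; rewrite horner_snd /= horner_coef0 coef_map.
  have pE h k : stabilizer_SL3 act w0 h -> local_ring (invmx h) p`_k.
    move=> [dh hw]; have /S0E[psi [N [E ->]]] := polyOverP pS k.
    have -> : polyfun psi w0 = N.@[mxvec (invmx h) 0].
      by rewrite E ?det_inv ?dh ?invr1 // invmxK hw.
    by apply: generic_mx_eval; rewrite det_inv dh invr1.
  pose r := \poly_(k < n.+1) (p`_(n - k)).2.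
  have -> : (p`_0).2 = r`_n by rewrite coef_poly ltnSn subnn.
  suff -> : r = 0 by rewrite coef0.
  apply: contrapT => /eqP /finite_roots; apply: contra_not Vinf.
  apply: sub_finite_set => _ [h Hh <-]; rewrite /= /root.
  have [T TE] := subring_pred (local_ring_subring (invmx h)).
  apply/eqP/(local_ring_fun (A := invmx h))/TE.
  have -> : (0, r.[invmx h i j]) =
      \sum_(k < n.+1) p`_(n - k) * (y, invmx h i j) ^+ k.
    have pairE k : p`_(n - k) * (y, invmx h i j) ^+ k =
        ((p`_(n - k)).1 * y ^+ k, (p`_(n - k)).2 * invmx h i j ^+ k).
      by rewrite [LHS]surjective_pairing !rmorphM !rmorphXn.
    under [RHS]eq_bigr do rewrite pairE.
    rewrite [RHS]surjective_pairing !rmorph_sum /=; congr (_, _).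
      rewrite -[LHS](mulr0 (y ^+ n)) -[X in _ * X = _]p1 big_distrr /=.
      rewrite [RHS](reindex_inj rev_ord_inj) /=; apply: eq_bigr => k _.
      have k_le : (k <= n)%N by rewrite -ltnS.
      rewrite subSS subKn // mulrCA; congr (_ * _).
      by rewrite expfB_cond // (negPf y0) add0n.
    by rewrite horner_poly.
  apply: rpred_sum => k _; apply: rpredM; first exact/TE/pE.
  exact/rpredX/TE/locV.
have [S S1S Sp] := place_extension S1p; exists S; split=> // [|psi N E].
  move=> Mint; have /integralP[c yc] := Mint i j; have := S1S _ (proj2 (S1E _) (adjoin_gen _ _)).
  move=> /(rpredM yc); rewrite pairM (divff y0) mulr0 => /(rpredB (rpred1 S)).
  have -> : 1 - (1, 0) = (0, 1) :> L * K by congr (_, _); rewrite ?subrr ?subr0.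
  by move=> /Sp.1.2/eqP; rewrite oner_eq0.
apply/integralP; exists (polyfun psi w0); apply/S1S/S1E/adjoin_base/S0E.
by exists psi, N.
Qed.

Theorem not_stable_pole : ~ stable act w0 ->
  exists S : subringClosed (L * K)%type, pole_of_orbit S.
Proof.
move=> nst; have [st|] := pselect (finite_set (stabilizer_SL3 act w0)); last first.
  exact: pole_of_infinite_stabilizer.
have [w [cl worb]] : exists w, zariski_closure (orbit_SL3 act w0) w /\
    ~ orbit_SL3 act w0 w.
  apply: contrapT => now; apply: nst; split=> //; apply/seteqP; split=> w cl.
    by apply: contrapT => worb; apply: now; exists w.
  by move=> p; apply.
exact: pole_of_boundary cl worb.
Qed.

End ValuativeCriterion.

(** * Integer solutions of linear inequalities *)
Lemma seq_max (s : seq rat) : s != [::] -> exists2 m, m \in s & forall x, x \in s -> x <= m.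
Proof.
elim: s => // a s IHs _; have [->|/IHs[m ms mP]] := eqVneq s [::].
  by exists a; rewrite ?mem_head // => x; rewrite inE => /eqP ->.
have [am|ma] := leP a m.
  by exists m; rewrite ?in_cons ?ms ?orbT // => x; rewrite in_cons => /predU1P[->|/mP].
exists a; rewrite ?mem_head // => x; rewrite in_cons => /predU1P[->//|/mP xm].
exact: le_trans xm (ltW ma).
Qed.

Lemma seq_min (s : seq rat) : s != [::] -> exists2 m, m \in s & forall x, x \in s -> m <= x.
Proof.
move=> s0; have [|m] := @seq_max (map -%R s); first by rewrite -size_eq0 size_map size_eq0.
move=> /mapP[x xs ->] mP; exists x => // y ys.
by rewrite -lerN2 mP ?map_f.
Qed.

Lemma rational_cut (b : bool) (ls us : seq rat) :
  (forall l u, l \in ls -> u \in us -> l < u ?<= if b) ->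
  exists r, (forall l, l \in ls -> l < r ?<= if b) /\
            (forall u, u \in us -> r < u ?<= if b).
Proof.
move=> lu; have [l0|/seq_max[l ls_l lmax]] := eqVneq ls [::].
  have [u0|/seq_min[u us_u umin]] := eqVneq us [::].
    by exists 0; rewrite l0 u0.
  exists (u - 1); rewrite l0; split=> // x /umin ux.
  by case: (b) => /=; lra.
have [u0|/seq_min[u us_u umin]] := eqVneq us [::].
  exists (l + 1); rewrite u0; split=> // x /lmax lx.
  by case: (b) => /=; lra.
exists ((l + u) / 2); have := lu _ _ ls_l us_u.
by split=> x => [/lmax|/umin]; move: H; case: (b) => /=; lra.
Qed.

(** [C] is the set of pairs [(i, j)] with [0 <= i * alpha + j * beta], for
    [alpha] and [beta] in an ordered abelian group and [beta] positive. *)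
Section HalfPlane.
Variable C : int -> int -> Prop.
Hypotheses (C0 : C 0 0)
  (CD : forall i j i' j', C i j -> C i' j' -> C (i + i') (j + j'))
  (Ctot : forall i j, C i j \/ C (- i) (- j)) (CN1 : ~ C 0 (- 1)).

(** Weak inequality if [b], strict inequality otherwise. *)
Definition half_plane (b : bool) i j := if b then C i j else ~ C (- i) (- j).

Lemma half_plane_mul i j n : C i j -> C (i * n%:Z) (j * n%:Z).
Proof.
move=> Cij; elim: n => [|n IHn]; first by rewrite !mulr0.
by rewrite intS !mulrDr !mulr1; exact: CD.
Qed.

Lemma half_plane_vert b j : half_plane b 0 j -> 0 < j ?<= if b.
Proof.
have C01 : C 0 1 by case: (Ctot 0 1) => //; rewrite oppr0.
have C0n (n : nat) : C 0 n%:Z by have := half_plane_mul n C01; rewrite mul0r mul1r.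
case: b => /= Cj.
  rewrite leNgt; apply/negP => j0; apply: CN1.
  have := CD Cj (C0n `|j|.-1%N); rewrite add0r.
  by have -> : j + `|j|.-1%N%:Z = - 1 by lia.
rewrite ltNge; apply/negP => j0; apply: Cj; rewrite oppr0.
by have -> : - j = `|j|%N%:Z by lia.
Qed.

Lemma slope_le b (i j i' j' : int) : 0 < i -> 0 < i' ->
  0 < j * i' + j' * i ?<= if b ->
  - j%:~R / i%:~R < j'%:~R / i'%:~R ?<= if b :> rat.
Proof.
move=> i0 i'0; have [I I'] : 0 < i%:~R :> rat /\ 0 < i'%:~R :> rat by rewrite !ltr0z.
case: b => /= H; [rewrite ler_pdivrMr // mulrAC ler_pdivlMr //|
  rewrite ltr_pdivrMr // mulrAC ltr_pdivlMr //];
  by rewrite -mulrNz -!intrM ?ler_int ?ltr_int; lia.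
Qed.

Lemma half_planeD b i j i' j' :
  half_plane b i j -> half_plane b i' j' -> half_plane b (i + i') (j + j').
Proof.
case: b => /=; first exact: CD.
move=> nC nC' CC; case: (Ctot i j) => // Cij; apply: nC'.
by have := CD Cij CC; rewrite !opprD !addNKr.
Qed.

Lemma half_planeM b i j n : half_plane b i j -> half_plane b (i * n.+1%:Z) (j * n.+1%:Z).
Proof.
move=> H; elim: n => [|n IHn]; first by rewrite !mulr1.
by rewrite intS !mulrDr !mulr1; exact: half_planeD.
Qed.

(** The pairs with [i] positive bound the ratio of [alpha] to [beta] from
    below and those with [i] negative from above.  Adding multiples of a pair
    of each kind shows that every lower bound is below every upper bound, so a
    rational number separates them. *)
Lemma half_plane_functional b (s : seq (int * int)) :
  (forall x, x \in s -> half_plane b x.1 x.2) ->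
  exists p q : int, 0 < q /\ forall x, x \in s -> 0 < x.1 * p + x.2 * q ?<= if b.
Proof.
move=> sH; pose slope (x : int * int) : rat := - x.2%:~R / x.1%:~R.
have [|r [rl ru]] := @rational_cut b [seq slope x | x <- s & 0 < x.1]
    [seq slope x | x <- s & x.1 < 0].
  move=> _ _ /mapP[[i j] + ->] /mapP[[i' j'] + ->]; rewrite !mem_filter /=.
  move=> /andP[i0 /sH /= Hij] /andP[i'0 /sH /= Hij'].
  have mE : i = (`|i|.-1).+1%N%:Z by lia.
  have m'E : - i' = (`|i'|.-1).+1%N%:Z by lia.
  have := half_planeD (half_planeM `|i'|.-1 Hij) (half_planeM `|i|.-1 Hij').
  rewrite -mE -m'E mulrN [i' * i]mulrC addNr => /half_plane_vert H.
  have -> : slope (i', j') = j'%:~R / (- i')%:~R.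
    by rewrite /slope /= mulrNz invrN mulrN mulNr.
  by apply: slope_le => //; rewrite oppr_gt0.
have r0 : 0 < (denq r)%:~R :> rat by rewrite ltr0z denq_gt0.
exists (numq r), (denq r); split=> [|[i j] ijs /=]; first exact: denq_gt0.
have qE : (i * numq r + j * denq r)%:~R = (r * i%:~R + j%:~R) * (denq r)%:~R.
  by rewrite rmorphD !rmorphM /= numqE; ring.
suff : 0 < r * i%:~R + j%:~R ?<= if b.
  by case: (b) => /= H; [rewrite -(ler0z rat) qE pmulr_lge0|rewrite -(ltr0z rat) qE pmulr_lgt0].
rewrite -lteifBlDr sub0r; have [i0|i0|i0] := ltgtP i 0.
- have /ru : slope (i, j) \in [seq slope x | x <- s & x.1 < 0].
    by apply: map_f; rewrite mem_filter i0.
  by rewrite lteif_ndivlMr ?ltrz0.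
- have /rl : slope (i, j) \in [seq slope x | x <- s & 0 < x.1].
    by apply: map_f; rewrite mem_filter i0.
  by rewrite lteif_pdivrMr ?ltr0z.
have := sH _ ijs; rewrite i0 /= => /half_plane_vert; rewrite mulr0.
by case: (b) => /=; rewrite ?oppr_le0 ?oppr_lt0 ?ler0z ?ltr0z.
Qed.
End HalfPlane.

Lemma big_ord3 (R : Type) (idx : R) (op : Monoid.com_law idx) (i j k : 'I_3)
    (F : 'I_3 -> R) :
  uniq [:: i; j; k] -> \big[op/idx]_x F x = op (F i) (op (F j) (F k)).
Proof.
move=> u; have sub : {subset [:: i; j; k] <= enum 'I_3} by move=> x _; rewrite mem_enum.
have [|_ eq_mem] := uniq_min_size u sub; first by rewrite size_enum_ord.
have e : perm_eq (enum 'I_3) [:: i; j; k].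
  by apply: uniq_perm; rewrite ?enum_uniq // => x; rewrite eq_mem.
by rewrite -big_enum /= (perm_big _ e) !big_cons big_nil Monoid.mulm1.
Qed.

Lemma ord3_complete (i : 'I_3) : exists j k : 'I_3, uniq [:: i; j; k].
Proof. by case: i => [[|[|[|//]]] ?]; [exists 1, 2|exists 0, 2|exists 0, 1]. Qed.

(** * From a valuation to a one-parameter subgroup *)
Section TorusWeights.
Variables (K : closedFieldType) (L : fieldType) (iota : {rmorphism K -> L}).
Variable S : subringClosed (L * K)%type.
Hypothesis Sp : place iota S.
Local Notation O := (integral S).

Definition weight (n : 'I_3 -> int) (m : 'X_{1..3}) : int := \sum_i n i * (m i)%:Z.

(** The valuations of the [a i] have sum 0 and one of them, at [i0], is
    negative.  A monomial depends up to units on two integers only, so this is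
    the problem of the half plane with [beta] the opposite of the valuation
    of [a i0]. *)
Lemma torus_weights (a : 'I_3 -> L) (b : bool) (s : seq 'X_{1..3}) :
  (forall i, a i != 0) -> \prod_i a i \in O -> (\prod_i a i)^-1 \in O ->
  ~ (forall i, a i \in O) ->
  (forall m, m \in s -> if b then mmap1 a m \in O else mmap1 a m \in max_ideal S) ->
  exists n : 'I_3 -> int, [/\ \sum_i n i = 0, exists i, n i != 0
    & forall m, m \in s -> 0 < weight n m ?<= if b].
Proof.
move=> a0 aO aVO naO sO.
have [i0 ai0] : exists i, a i \notin O.
  by apply: contrapT => noi; apply: naO => i; apply: contrapT => /negP ai; apply: noi; exists i.
have [j0 [k0 u]] := ord3_complete i0.
pose mon i j := a j0 ^ i * a i0 ^ (- j).
have monD i j i' j' : mon (i + i') (j + j') = mon i j * mon i' j'.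
  by rewrite /mon opprD !expfzDr // mulrACA.
have monN i j : mon (- i) (- j) = (mon i j)^-1 by rewrite /mon invfM !invr_expz.
pose C i j := mon i j \in O.
have C0 : C 0 0 by rewrite /C /mon oppr0 !expr0z mulr1 rpred1.
have CD i j i' j' : C i j -> C i' j' -> C (i + i') (j + j').
  by move=> Cij Cij'; rewrite /C monD; exact: rpredM.
have Ctot i j : C i j \/ C (- i) (- j).
  by rewrite /C monN; apply/orP; exact: integral_or_inv Sp _.
have CN1 : ~ C 0 (- 1) by rewrite /C /mon opprK expr0z mul1r expr1z; exact/negP.
(* Exponents of [a j0] and of [(a i0)^-1] once [a k0] has been eliminated by
   means of the product of the [a i]. *)
pose v (m : 'X_{1..3}) : int * int := ((m j0)%:Z - (m k0)%:Z, (m k0)%:Z - (m i0)%:Z).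
have vE m : mmap1 a m = mon (v m).1 (v m).2 * (\prod_i a i) ^+ m k0.
  have sub x (k l : nat) : x != 0 -> x ^+ k = x ^ (k%:Z - l%:Z) * x ^+ l :> L.
    by move=> x0; rewrite !exprnP -expfzDr // subrK.
  rewrite /mmap1 !(big_ord3 _ _ u) /mon /= opprB.
  by rewrite (sub _ (m i0) (m k0)) // (sub _ (m j0) (m k0)) // !exprMn; ring.
have PVO k : (\prod_i a i) ^- k \in O by rewrite -exprVn rpredX.
have P0 k : (\prod_i a i) ^+ k != 0 by rewrite expf_neq0 //; apply/prodf_neq0 => i _; exact: a0.
have sH x : x \in map v s -> half_plane C b x.1 x.2.
  move=> /mapP[m /sO + ->]; move: (vE m); set y := mon _ _ => vEm.
  have yE : y = mmap1 a m * (\prod_i a i) ^- m k0 by rewrite vEm mulfK.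
  case: b {sO} => /= mO; first by rewrite /C -/y yE rpredM.
  rewrite /C monN -/y => yV; move: mO; rewrite (max_ideal_inv Sp) => [/negP|].
    by apply; rewrite vEm invfM; exact: rpredM.
  by apply/prodf_neq0 => i _; rewrite expf_neq0.
have [p [q [q0 pq]]] := half_plane_functional C0 CD Ctot CN1 sH.
exists (fun i => if i == i0 then - q else if i == j0 then p else q - p).
have /and4P[/norP[ij /norP[ik _]] /norP[jk _] _ _] := u.
have [ji ki kj] : [/\ j0 == i0 = false, k0 == i0 = false & k0 == j0 = false].
  by split; rewrite eq_sym; apply/negbTE.
split.
- by rewrite (big_ord3 _ _ u) /= !eqxx ji ki kj; ring.
- by exists i0; rewrite eqxx oppr_eq0 gt_eqF.
move=> m ms; have := pq _ (map_f v ms).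
rewrite /weight (big_ord3 _ _ u) /= !eqxx ji ki kj.
by congr (_ < _ ?<= if _); ring.
Qed.
End TorusWeights.

(** * Linear substitutions *)
Definition row_form (R : comNzRingType) (A : 'M[R]_3) (i : 'I_3) : {mpoly R[3]} :=
  \sum_j A i j *: 'X_j.

HB.lock Definition subst (R : comNzRingType) (A : 'M[R]_3) (F : {mpoly R[3]}) :
  {mpoly R[3]} := mmap (@mpolyC 3 R) (row_form A) F.

Canonical subst_unlockable := Unlockable subst.unlock.

Section Substitution.
Variable R : comNzRingType.
Implicit Types (A B : 'M[R]_3) (F G : {mpoly R[3]}).

Lemma substE A F : subst A F = mmap (@mpolyC 3 R) (row_form A) F.
Proof. by rewrite unlock. Qed.

Fact subst_is_zmod_morphism A : zmod_morphism (subst A).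
Proof. by move=> F G; rewrite !substE rmorphB. Qed.
Fact subst_is_monoid_morphism A : monoid_morphism (subst A).
Proof. by split=> [|F G]; rewrite !substE ?rmorph1 ?rmorphM. Qed.
HB.instance Definition _ A := GRing.isZmodMorphism.Build _ _ (subst A)
  (subst_is_zmod_morphism A).
HB.instance Definition _ A := GRing.isMonoidMorphism.Build _ _ (subst A)
  (subst_is_monoid_morphism A).

Lemma substZ A c F : subst A (c *: F) = c *: subst A F.
Proof. by rewrite !substE mmapZ mul_mpolyC. Qed.

Lemma substC A c : subst A c%:MP = c%:MP.
Proof. by rewrite substE mmapC. Qed.

Lemma substX A i : subst A 'X_i = row_form A i.
Proof. by rewrite substE mmapX mmap1U. Qed.

Lemma subst_comp A B F : subst B (subst A F) = subst (A *m B) F.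
Proof.
rewrite (substE A) rmorph_mmap substE; apply: eq_mmap => [c|i] /=; first exact: substC.
rewrite /row_form rmorph_sum /=.
under eq_bigr do rewrite substZ substX /row_form scaler_sumr.
rewrite exchange_big; apply: eq_bigr => k _ /=.
by rewrite mxE scaler_suml; apply: eq_bigr => j _; rewrite scalerA.
Qed.

Lemma subst1 F : subst 1%:M F = F.
Proof.
elim/mpolyind: F => [|c m F _ _ IH]; first exact: rmorph0.
rewrite rmorphD /= IH substZ; congr (_ *: _ + _).
rewrite substE mmapX -[RHS]mmap1_id; apply: mmap1_eq => i.
rewrite /row_form (bigD1 i) //= mxE eqxx scale1r big1 ?addr0 // => j ji.
by rewrite mxE eq_sym (negPf ji) scale0r.
Qed.

Lemma subst_diagX (a : 'rV[R]_3) k :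
  subst (diag_mx a) 'X_[k] = mmap1 (a 0) k *: 'X_[k].
Proof.
rewrite substE mmapX mpolyXE_id -mul_mpolyC /mmap1 rmorph_prod -big_split /=.
apply: eq_bigr => i _; rewrite rmorphXn -exprMn; congr (_ ^+ _).
rewrite /row_form (bigD1 i) //= mxE eqxx mulr1n mul_mpolyC big1 ?addr0 // => j ji.
by rewrite mxE eq_sym (negPf ji) mulr0n scale0r.
Qed.

Lemma subst_diag (a : 'rV[R]_3) F m : (subst (diag_mx a) F)@_m = F@_m * mmap1 (a 0) m.
Proof.
elim/mpolyind: F => [|c k F _ _ IH]; first by rewrite rmorph0 mcoeff0 mul0r.
rewrite rmorphD /= !mcoeffD IH substZ !mcoeffZ mulrDl subst_diagX mcoeffZ !mcoeffX.
by congr (_ + _); case: eqP => [->|_]; rewrite ?mulr1 ?mulr0 ?mul0r.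
Qed.

End Substitution.

Lemma subst_map (R1 R2 : comNzRingType) (phi : {rmorphism R1 -> R2}) A F :
  map_mpoly phi (subst A F) = subst (map_mx phi A) (map_mpoly phi F).
Proof.
rewrite substE /map_mpoly !rmorph_mmap; apply: eq_mmap => [c|i] /=.
  by rewrite [mmap _ _ _]mmapC substC.
rewrite substX /row_form rmorph_sum; apply: eq_bigr => j _ /=.
by rewrite mxE -/(map_mpoly phi _) map_mpolyZ map_mpolyX.
Qed.

Section CoefficientPolynomials.
Variables (K : closedFieldType) (f : {mpoly K[3]}) (m : 'X_{1..3}).

(** The coefficient of [m] in the form [f] transformed by a matrix, as a
    polynomial in the entries of this matrix. *)
Definition coefficient_poly : {mpoly K[3 * 3]} :=
  (subst (coord_mx K 2) (map_mpoly (@mpolyC (3 * 3) K) f))@_m.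

Lemma mx_eval_coef (B : comNzRingType) (h : {rmorphism K -> B}) (A : 'M[B]_3) :
  mx_eval h A coefficient_poly = (subst A (map_mpoly h f))@_m.
Proof.
rewrite /mx_eval /coefficient_poly -mcoeff_map_mpoly subst_map; congr (subst _ _)@_m.
  by apply/matrixP => i j; rewrite [LHS]mxE; exact: mx_eval_coord.
by apply/mpolyP => k; rewrite !mcoeff_map_mpoly /= mmapC.
Qed.

Lemma meval_coef (A : 'M[K]_3) : coefficient_poly.@[mxvec A 0] = (subst A f)@_m.
Proof.
rewrite [LHS](mx_eval_coef idfun); congr (subst _ _)@_m.
by apply/mpolyP => k; rewrite mcoeff_map_mpoly.
Qed.

End CoefficientPolynomials.


(** * Destabilizing one-parameter subgroups *)

(** A polynomial that vanishes on [A] is, along the curve, a polynomial in [t]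
    that vanishes for all nonzero [t], hence also for [t = 0]. *)
Lemma closure_of_curve (K : closedFieldType) (W : vectType K) (A : set W)
    (I : Type) (s : seq I) (e : I -> nat) (w : I -> W) :
  (forall t, t != 0 -> A (\sum_(i <- s) t ^+ e i *: w i)) ->
  zariski_closure A (\sum_(i <- s) 0 ^+ e i *: w i).
Proof.
move=> At p pA; pose r k : {poly K} := \sum_(i <- s) coord (vbasis {:W}) k (w i) *: 'X^(e i).
pose Q : {poly K} := mmap polyC r p.
have QE t : Q.[t] = polyfun p (\sum_(i <- s) t ^+ e i *: w i).
  rewrite -[LHS]/(horner_eval t Q) rmorph_mmap; apply: eq_mmap => [c|k] /=.
    by rewrite /horner_eval hornerC.
  rewrite /r /horner_eval horner_sum linear_sum; apply: eq_bigr => i _.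
  by rewrite hornerZ hornerXn linearZ mulrC.
rewrite -QE; suff -> : Q = 0 by rewrite horner0.
apply: contrapT => /eqP Q0; have /closed_nonrootP[t] : Q * 'X != 0.
  by rewrite mulf_neq0 ?polyX_eq0.
rewrite rootM rootX negb_or => /andP[/negP Qt t0]; apply: Qt.
by rewrite /root QE pA //; exact: At.
Qed.

Section Destabilizing.
Variables (K : numClosedFieldType) (d : nat).
Implicit Types (q : ternary_form K d).

Lemma comp_linear_forms (A : 'M[K]_3) (G : {mpoly K[3]}) :
  G \mPo linear_forms A = subst A G.
Proof. by rewrite /comp_mpoly substE; apply: eq_mmap => // i; rewrite tnth_mktuple. Qed.

Lemma lin_changeE g q : lin_change g q = subst (invmx g) q :> {mpoly K[3]}.
Proof. exact: comp_linear_forms. Qed.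

Lemma lin_changeM a b q : a \in unitmx -> b \in unitmx ->
  lin_change (a *m b) q = lin_change a (lin_change b q).
Proof.
move=> ua ub; apply: val_inj; rewrite /= !comp_linear_forms subst_comp; congr subst.
have uab : a *m b \in unitmx by rewrite unitmx_mul ua.
by rewrite -[RHS](mulmxK uab) mulmxA mulmxKV // mulVmx // mul1mx.
Qed.

Lemma lin_change1 q : lin_change 1%:M q = q.
Proof. by apply: val_inj; rewrite /= comp_linear_forms invmx1 subst1. Qed.

Definition monomial_form (m : 'X_{1..3}) : ternary_form K d := indhomog d 'X_[m].

Lemma val_monomial_form m : mdeg m = d -> monomial_form m = 'X_[m] :> {mpoly K[3]}.
Proof. by move=> md; rewrite -[LHS]/(val _) insubdK // dhomogX /= md. Qed.

Lemma mdeg_msupp q m : m \in msupp (q : {mpoly K[3]}) -> mdeg m = d.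
Proof. exact: (dhomog_mf (dhomog_is_dhomog q)). Qed.

Variables (q : ternary_form K d) (h : 'M[K]_3) (n : 'I_3 -> int).
Hypotheses (h_unit : h \in unitmx) (n_sum0 : \sum_i n i = 0).
Let F : {mpoly K[3]} := subst h q.
Hypothesis F_ge0 : forall m, m \in msupp F -> 0 <= weight n m.

Definition torus (t : K) : 'M[K]_3 := diag_mx (\row_i t ^ n i).
Definition psubgroup (t : K) : 'M[K]_3 := invmx (h *m torus t *m invmx h).

Lemma det_torus t : t != 0 -> \det (torus t) = 1.
Proof.
move=> t0; rewrite det_diag; under eq_bigr do rewrite mxE.
by rewrite -(big_morph (fun j : int => t ^ j) (fun i j => expfzDr i j t0) (expr0z t)) n_sum0.
Qed.

Lemma det_psubgroup t : t != 0 -> \det (psubgroup t) = 1.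
Proof.
move=> t0; rewrite det_inv !det_mulmx det_torus // mulr1 det_inv divff ?invr1 //.
by rewrite -unitfE -unitmxE.
Qed.

Lemma torus_monomial (t : K) m : t != 0 -> mmap1 ((\row_i t ^ n i) 0) m = t ^ weight n m.
Proof.
move=> t0; rewrite /mmap1 /weight; elim/big_rec2: _ => [|i x y _ ->]; first by rewrite expr0z.
by rewrite mxE expfzDr // exprnP exprz_exp.
Qed.

Let term m := lin_change h (F@_m *: monomial_form m).

Let F_deg m : m \in msupp F -> mdeg m = d.
Proof. by rewrite /F -[h]invmxK -lin_changeE; exact: mdeg_msupp. Qed.

Lemma psubgroup_orbit t : t != 0 -> lin_change (psubgroup t) q =
  \sum_(m <- msupp F) t ^+ `|weight n m|%N *: term m.
Proof.
move=> t0; apply: val_inj; rewrite /= comp_linear_forms invmxK [in RHS]raddf_sum /=.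
have FE : subst (torus t) F = \sum_(m <- msupp F) F@_m *: (t ^ weight n m *: 'X_[m]).
  transitivity (subst (torus t) (\sum_(m <- msupp F) F@_m *: 'X_[m])).
    by rewrite -mpolyE.
  rewrite rmorph_sum; apply: eq_bigr => m _.
  by rewrite /= substZ subst_diagX torus_monomial.
rewrite -!subst_comp -/F FE rmorph_sum big_seq [RHS]big_seq; apply: eq_bigr => m mF.
rewrite linearZ /= comp_linear_forms linearZ /= val_monomial_form ?F_deg //.
by rewrite !substZ !scalerA mulrC exprnP gez0_abs ?F_ge0.
Qed.

(** With [0 ^+ 0 = 1], the terms of weight 0 remain. *)
Definition limit_form : ternary_form K d :=
  \sum_(m <- msupp F) 0 ^+ `|weight n m|%N *: term m.

Lemma limit_form_closure : zariski_closure (orbit_SL3 (@lin_change K d) q) limit_form.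
Proof.
apply: closure_of_curve => t t0; rewrite -psubgroup_orbit //.
by exists (psubgroup t); rewrite //= det_psubgroup.
Qed.

Lemma limit_form_fixed t : t != 0 -> lin_change (psubgroup t) limit_form = limit_form.
Proof.
move=> t0; rewrite /limit_form linear_sum big_seq [RHS]big_seq; apply: eq_bigr => m mF.
rewrite linearZ /=; have [w0|w0] := eqVneq `|weight n m|%N 0%N; last first.
  by rewrite expr0n (negPf w0) !scale0r.
congr (_ *: _); apply: val_inj; rewrite /= comp_linear_forms invmxK /= comp_linear_forms.
rewrite val_monomial_form ?F_deg // subst_comp !mulmxA mulVmx // mul1mx.
rewrite -subst_comp substZ subst_diagX torus_monomial //.
by move/eqP: w0; rewrite absz_eq0 => /eqP ->; rewrite expr0z scale1r.
Qed.

Lemma not_semistable : (forall m, m \in msupp F -> 0 < weight n m) ->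
  ~ semistable_curve q.
Proof.
move=> F_gt0; apply; suff <- : limit_form = 0 by exact: limit_form_closure.
rewrite /limit_form big_seq big1 // => m /F_gt0 w0.
by rewrite expr0n absz_eq0 gt_eqF // scale0r.
Qed.

(** The limit lies in the orbit, as [g0 q], and is fixed by the subgroup.  The
    conjugates by [g0] of its values at the powers of 2 are infinitely many
    elements of the stabilizer of [q]. *)
Lemma not_stable : (exists i, n i != 0) -> ~ stable_curve q.
Proof.
move=> [i ni] [cl fin]; have := limit_form_closure; rewrite cl => -[g0 /= dg0 g0q].
have g0u : g0 \in unitmx by rewrite unitmxE dg0 unitr1.
(* Powers of 2 because they are distinct in characteristic 0. *)
pose s (j : nat) := invmx g0 *m psubgroup (2 ^+ j) *m g0.
have two0 j : 2 ^+ j != 0 :> K by rewrite expf_neq0 // pnatr_eq0.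
have s_stab j : stabilizer_SL3 (@lin_change K d) q (s j).
  split; first by rewrite !det_mulmx det_psubgroup // mulr1 det_inv dg0 invr1 mulr1.
  have pu : psubgroup (2 ^+ j) \in unitmx by rewrite unitmxE det_psubgroup ?unitr1.
  have gV : invmx g0 \in unitmx by rewrite unitmx_inv.
  have pg : psubgroup (2 ^+ j) *m g0 \in unitmx by rewrite unitmx_mul pu.
  rewrite /s -mulmxA lin_changeM // lin_changeM // g0q limit_form_fixed //.
  by rewrite -g0q -lin_changeM // mulVmx // lin_change1.
have s_inj : injective s.
  move=> j j' /(congr1 (fun A => g0 *m A *m invmx g0)) /=.
  rewrite /s !mulmxA mulmxV // !mul1mx !mulmxK //.
  move=> /(congr1 invmx); rewrite !invmxK => /(congr1 (fun A => invmx h *m A *m h)) /=.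
  rewrite !mulmxA mulVmx // !mul1mx !mulmxKV //.
  move=> /matrixP/(_ i i); rewrite !mxE eqxx !mulr1n.
  have pow a b k : (2 ^+ a) ^+ k.+1 = (2 ^+ b) ^+ k.+1 :> K -> a = b.
    by rewrite -!exprM -!natrX => /eqP; rewrite eqr_nat eqn_exp2l // eqn_pmul2r // => /eqP.
  case: (n i) ni => [[//|k] _|k _]; first by rewrite -!exprnP; exact: pow.
  by rewrite /exprz => /invr_inj; exact: pow.
apply: infinite_nat.
have := finite_preimage (in2W s_inj) fin.
by apply: sub_finite_set => j _; exact: s_stab.
Qed.
End Destabilizing.

Section Destabilized.
Variables (K : numClosedFieldType) (d : nat).
Notation form := (ternary_form K d).

(** All the weights of [q] for some nontrivial diagonal one-parameter subgroup,
    in some coordinates, are nonnegative if [b], positive otherwise. *)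
Definition destabilized (b : bool) (q : form) := exists h (n : 'I_3 -> int),
  [/\ h \in unitmx, \sum_i n i = 0, exists i, n i != 0 &
    forall m, m \in msupp (subst h q) -> 0 < weight n m ?<= if b].

Lemma destabilizedZ b (q : form) c : c != 0 -> destabilized b (c *: q) -> destabilized b q.
Proof.
move=> c0 [h [n [hu n0 ni nw]]]; exists h, n.
split; [exact: hu|exact: n0|exact: ni|move=> m mq; apply: nw].
move: mq; rewrite !mcoeff_msupp (_ : ((c *: q : form) : {mpoly K[3]}) = c *: (q : {mpoly K[3]})) //.
by rewrite substZ (mcoeffZ c) mulf_eq0 negb_or c0.
Qed.

Lemma semistable_not_destabilized (q : form) : semistable_curve q -> ~ destabilized false q.
Proof.
move=> qs [h [n [hu n0 _ nw]]]; apply: (not_semistable hu n0 _ nw qs) => m /nw.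
exact: ltW.
Qed.

Lemma stable_not_destabilized (q : form) : stable_curve q -> ~ destabilized true q.
Proof. by move=> qs [h [n [hu n0 ni nw]]]; exact: (not_stable hu n0 nw ni qs). Qed.

Lemma destabilized_weaken (q : form) : destabilized false q -> destabilized true q.
Proof.
move=> [h [n [hu n0 ni nw]]]; exists h, n; split=> // m /nw; exact: ltW.
Qed.

End Destabilized.

(** * Plücker coordinates as functions of a matrix *)
Section PluckerRegularity.
Variables (K : numClosedFieldType) (d : nat).
Notation form := (ternary_form K d).

Definition regular_fun (phi : 'M[K]_3 -> K) : Prop :=
  exists N : {mpoly K[3 * 3]}, forall A, phi A = N.@[mxvec A 0].

Lemma regular_sum (I : Type) (s : seq I) (phi : I -> 'M[K]_3 -> K) :
  (forall i, regular_fun (phi i)) -> regular_fun (fun A => \sum_(i <- s) phi i A).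
Proof.
move=> /boolp.choice[N NE]; exists (\sum_(i <- s) N i) => A.
by rewrite rmorph_sum; apply: eq_bigr => i _; exact: NE.
Qed.

Lemma regular_mul (phi psi : 'M[K]_3 -> K) :
  regular_fun phi -> regular_fun psi -> regular_fun (fun A => phi A * psi A).
Proof. by move=> [N NE] [N' NE']; exists (N * N') => A; rewrite mevalM NE NE'. Qed.

Lemma regular_const c : regular_fun (fun=> c).
Proof. by exists c%:MP => A; rewrite mevalC. Qed.

Lemma form_monomials (u : form) :
  u = \sum_(m : 'X_{1..3 < d.+1}) (u : {mpoly K[3]})@_m *: monomial_form K d m.
Proof.
apply: val_inj; rewrite raddf_sum /= {1}[mpoly_of_dhomog u](@mpolywE _ _ d.+1); last first.
  rewrite mmeasureE; apply/bigmax_leqP_seq => m mu _.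
  by apply: eq_leq; congr _.+1; exact: mdeg_msupp mu.
apply: eq_bigr => m _; have [md|md] := eqVneq (mdeg m) d.
  by rewrite val_monomial_form.
rewrite (_ : (u : {mpoly K[3]})@_m = 0) ?scale0r //.
exact: (dhomog_nemf_coeff (dhomog_is_dhomog u)).
Qed.

Lemma regular_lin_change (l : {scalar form}) (u : form) :
  regular_fun (fun A => l (lin_change (invmx A) u)).
Proof.
have -> : (fun A => l (lin_change (invmx A) u)) = fun A =>
   \sum_(m : 'X_{1..3 < d.+1}) (lin_change (invmx A) u : {mpoly K[3]})@_m * l (monomial_form K d m).
  apply/funext => A; rewrite {1}[lin_change _ _]form_monomials linear_sum.
  by apply: eq_bigr => m _; rewrite linearZ.
apply: regular_sum => m; apply: regular_mul; last exact: regular_const.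
exists (coefficient_poly (u : {mpoly K[3]}) m) => A.
by rewrite lin_changeE invmxK meval_coef.
Qed.

Lemma ext2_val_linear c (X Y : ext2 form) i j :
  vsval (c *: X + Y) i j = c * vsval X i j + vsval Y i j.
Proof. by rewrite linearP !mxE. Qed.

Lemma wedgeE (u v : form) i j : vsval (wedge u v) i j =
  coord (vbasis fullv) i u * coord (vbasis fullv) j v -
  coord (vbasis fullv) i v * coord (vbasis fullv) j u.
Proof. by rewrite /= !mxE !big_ord1 !mxE; congr (_ - _). Qed.

Definition wedge_flip (v u : form) : ext2 form := wedge u v.

Lemma wedge_linear_l (v : form) : linear (wedge_flip v).
Proof.
move=> c u u'; apply: val_inj; apply/matrixP => i j.
apply: etrans (wedgeE _ _ i j) _; apply: etrans _ (esym (ext2_val_linear c _ _ i j)).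
by rewrite !wedgeE !linearP /=; ring.
Qed.

Lemma wedge_linear_r (u : form) : linear (wedge u : form -> ext2 form).
Proof.
move=> c v v'; apply: val_inj; apply/matrixP => i j.
apply: etrans (wedgeE _ _ i j) _; apply: etrans _ (esym (ext2_val_linear c _ _ i j)).
by rewrite !wedgeE !linearP /=; ring.
Qed.

HB.instance Definition _ v :=
  GRing.isLinear.Build K form (ext2 form) _ (wedge_flip v) (wedge_linear_l v).
HB.instance Definition _ u :=
  GRing.isLinear.Build K form (ext2 form) _ (wedge u) (wedge_linear_r u).

Lemma wedge_coord (u v : form) : wedge u v =
  \sum_i \sum_j (coord (vbasis fullv) i u * coord (vbasis fullv) j v) *:
    wedge (vbasis fullv)`_i (vbasis fullv)`_j :> ext2 form.
Proof.
have -> : wedge u v = \sum_i coord (vbasis fullv) i u *: wedge (vbasis fullv)`_i v :> ext2 form.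
  rewrite -[LHS]/(wedge_flip v u) {1}(coord_vbasis (memvf u)) linear_sum.
  by apply: eq_bigr => i _; rewrite linearZ.
apply: eq_bigr => i _.
rewrite {1}(coord_vbasis (memvf v)) linear_sum scaler_sumr.
by apply: eq_bigr => j _; rewrite linearZ scalerA.
Qed.

Lemma ext2_changeE g (u v : form) :
  ext2_change g (wedge u v) = wedge (lin_change g u) (lin_change g v).
Proof. by rewrite /ext2_change ext2_map_wedge !lfunE. Qed.

(** The wedge product is bilinear in the coordinates of the two forms, which
    are polynomials in the matrix. *)
Lemma ext2_change_regular (u v : form) i :
  exists N, pulls_back (@ext2_change K d) (wedge u v) 'X_i N.
Proof.
suff [N NE] : regular_fun (fun A => coord (vbasis fullv) i (ext2_change (invmx A) (wedge u v))).
  by exists N => A _; rewrite /polyfun mevalXU NE.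
have -> : (fun A => coord (vbasis fullv) i (ext2_change (invmx A) (wedge u v))) =
  fun A => \sum_j \sum_k (coord (vbasis fullv) j (lin_change (invmx A) u) *
     coord (vbasis fullv) k (lin_change (invmx A) v)) *
     coord (vbasis fullv) i (wedge (vbasis fullv)`_j (vbasis fullv)`_k : ext2 form).
  apply/funext => A; rewrite ext2_changeE wedge_coord linear_sum; apply: eq_bigr => j _.
  by rewrite linear_sum; apply: eq_bigr => k _; rewrite linearZ.
do 2 apply: regular_sum => ?.
by do ?apply: regular_mul;
  [exact: regular_lin_change|exact: regular_lin_change|exact: regular_const].
Qed.

Definition minor (R : nzRingType) (F G : {mpoly R[3]}) (m m' : 'X_{1..3}) : R :=
  F@_m * G@_m' - F@_m' * G@_m.

Lemma scalar_polyfun (W : vectType K) (l : {scalar W}) :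
  exists psi, forall w, polyfun psi w = l w.
Proof.
exists (\sum_(k < \dim {:W}) l (vbasis {:W})`_k *: 'X_k) => w.
rewrite [in RHS](coord_vbasis (memvf w)) linear_sum /polyfun rmorph_sum.
by apply: eq_bigr => k _; rewrite [LHS]mevalZ mevalXU linearZ mulrC.
Qed.

(** The minors of the coefficients of two forms are alternating in them, so
    they are linear functions of the wedge product. *)
Lemma minor_polyfun m m' : exists psi, forall u v : form,
  polyfun psi (wedge u v) = minor (u : {mpoly K[3]}) (v : {mpoly K[3]}) m m'.
Proof.
pose c k (i : 'I_(\dim {:form})) := (((vbasis {:form})`_i : form) : {mpoly K[3]})@_k.
pose l (X : ext2 form) := \sum_i \sum_j vsval X i j * c m i * c m' j.
have l_lin : scalar l.
  move=> a X Y; rewrite /l mulr_sumr -big_split; apply: eq_bigr => i _ /=.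
  rewrite mulr_sumr -big_split; apply: eq_bigr => j _ /=.
  by rewrite ext2_val_linear; ring.
pose L : {scalar ext2 form} := HB.pack l (GRing.isLinear.Build K (ext2 form) K *%R l l_lin).
have [psi psiE] := scalar_polyfun L; exists psi => u v; rewrite psiE -[LHS]/(l _) /l /minor.
have coefE (w : form) k : (w : {mpoly K[3]})@_k = \sum_i coord (vbasis fullv) i w * c k i.
  rewrite {1}(coord_vbasis (memvf w)) raddf_sum raddf_sum.
  by apply: eq_bigr => i _; rewrite /= mcoeffZ.
rewrite [X in _ - X]mulrC !coefE !big_distrlr -sumrB; apply: eq_bigr => i _.
by rewrite -sumrB; apply: eq_bigr => j _; rewrite wedgeE /=; ring.
Qed.

Lemma minor_pulls_back (u v : form) m m' :
  exists psi, pulls_back (@ext2_change K d) (wedge u v) psi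
    (coefficient_poly (u : {mpoly K[3]}) m * coefficient_poly (v : {mpoly K[3]}) m' -
     coefficient_poly (u : {mpoly K[3]}) m' * coefficient_poly (v : {mpoly K[3]}) m).
Proof.
have [psi psiE] := minor_polyfun m m'; exists psi => A _.
rewrite ext2_changeE psiE /minor !lin_changeE invmxK -!meval_coef.
by rewrite mevalB; congr (_ - _); exact: mevalM.
Qed.
End PluckerRegularity.

(** * A pencil at a pole of its orbit *)

(** A minor of a matrix product is a linear combination of minors of the first
    factor, with products of two entries of the second one as coefficients. *)
Lemma minor_lincomb (R : comNzRingType) (O : subringClosed R) (I : finType)
    (u v x y : I -> R) ux uy vx vy :
  ux = \sum_i u i * x i -> uy = \sum_i u i * y i ->
  vx = \sum_i v i * x i -> vy = \sum_i v i * y i ->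
  (forall i j, u i * v j - u j * v i \in O) ->
  (forall i, x i \in O) -> (forall i, y i \in O) ->
  ux * vy - uy * vx \in O.
Proof.
move=> -> -> -> -> uv xO yO; rewrite [X in _ - X]mulrC !big_distrlr -sumrB.
apply: rpred_sum => i _; rewrite -sumrB; apply: rpred_sum => j _ /=.
have -> : u i * x i * (v j * y j) - v i * x i * (u j * y j) =
    (u i * v j - u j * v i) * (x i * y j) by ring.
by rewrite rpredM // rpredM.
Qed.

Section PencilAtPole.
Variables (K : numClosedFieldType) (d : nat).
Variables (L : fieldType) (iota : {rmorphism K -> L}).
Notation form := (ternary_form K d).
Notation "f ^iota" := (map_mpoly iota (f : {mpoly K[3]})) (at level 2, format "f ^iota").

Variable S : subringClosed (L * K)%type.
Hypothesis Sp : place iota S.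
Local Notation O := (integral S).
Local Notation "p ~> q" := ((p, q) \in S) (at level 70).

Lemma integral_det n (A : 'M[L]_n) : integral_mx S A -> \det A \in O.
Proof.
move=> Ai; apply: rpred_sum => s _; rewrite rpredM ?rpredX ?rpredN1 //.
by apply: rpred_prod => i _; exact: Ai.
Qed.

Lemma subst_coef_integral (A : 'M[L]_3) (f : {mpoly K[3]}) m :
  integral_mx S A -> (subst A (map_mpoly iota f))@_m \in O.
Proof.
move=> Ai; rewrite -mx_eval_coef; apply: rpred_mmap => [c|k].
  exact: integral_iota Sp c.
by case/mxvec_indexP: k => i j; rewrite mxvecE.
Qed.

Lemma subst_coef_residue (A : 'M[L]_3) (B : 'M[K]_3) (f : {mpoly K[3]}) m :
  (forall i j, A i j ~> B i j) ->
  (subst A (map_mpoly iota f))@_m ~> (subst B f)@_m.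
Proof.
by move=> AB; rewrite -mx_eval_coef -meval_coef; apply: pair_mx_eval => // c; exact: Sp.1.1.
Qed.

Lemma residue_mx (A : 'M[L]_3) : integral_unitmx S A ->
  exists2 B, B \in unitmx & forall i j, A i j ~> B i j.
Proof.
have res (C : 'M[L]_3) : integral_mx S C -> exists D : 'M[K]_3, forall i j, C i j ~> D i j.
  move=> Ci; have /boolp.choice[r rP] (ij : 'I_3 * 'I_3) : exists y, C ij.1 ij.2 ~> y.
    by apply/(@integralP _ _ S); exact: Ci.
  by exists (\matrix_(i, j) r (i, j)) => i j; rewrite [X in (_, X)]mxE; exact: (rP (i, j)).
move=> [A' [/res[B AB] /res[B' AB']] AA']; exists B => //.
suff : B *m B' = 1%:M by case/mulmx1_unit.
apply/matrixP => i j; apply: (residue_uniq Sp (x := (A *m A') i j)).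
  have -> : ((A *m A') i j, (B *m B') i j) = \sum_k (A i k, B i k) * (A' k j, B' k j) :> L * K.
    by rewrite [RHS]surjective_pairing !rmorph_sum !mxE.
  by apply: rpred_sum => k _; apply: rpredM; [exact: AB|exact: AB'].
rewrite AA' !mxE; case: eqP => _; [exact: (rpred1 S)|exact: (rpred0 S)].
Qed.

Lemma subst_coef_sum (A : 'M[L]_3) N (F : {mpoly L[3]}) m : (msize F <= N)%N ->
  (subst A F)@_m = \sum_(n : 'X_{1..3 < N}) F@_n * (subst A 'X_[n])@_m.
Proof.
move=> FN; rewrite {1}(mpolywE FN) rmorph_sum raddf_sum; apply: eq_bigr => n _.
by rewrite /= substZ mcoeffZ.
Qed.

Lemma minor_subst (A : 'M[L]_3) (F G : {mpoly L[3]}) : integral_mx S A ->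
  (forall m m', minor F G m m' \in O) ->
  forall m m', minor (subst A F) (subst A G) m m' \in O.
Proof.
move=> Ai FG m m'; pose N := maxn (msize F) (msize G).
have X_int k k' : (subst A 'X_[k])@_k' \in O.
  by rewrite -(map_mpolyX iota); exact: subst_coef_integral.
have FE k : (subst A F)@_k = \sum_(n : 'X_{1..3 < N}) F@_n * (subst A 'X_[n])@_k.
  by apply: subst_coef_sum; rewrite leq_maxl.
have GE k : (subst A G)@_k = \sum_(n : 'X_{1..3 < N}) G@_n * (subst A 'X_[n])@_k.
  by apply: subst_coef_sum; rewrite leq_maxr.
apply: (@minor_lincomb _ O _ _ _ _ _ _ _ _ _ (FE m) (FE m') (GE m) (GE m')).
- by move=> n n'; exact: FG.
- by move=> n; exact: X_int.
- by move=> n; exact: X_int.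
Qed.

Lemma max_idealM x y : x \in max_ideal S -> y \in O -> x * y \in max_ideal S.
Proof.
move=> xm /integralP[c yc]; rewrite max_idealE.
by have := rpredM (xm : x ~> 0) yc; rewrite pairM mul0r.
Qed.

Variables (k : 'M[L]_3) (A : 'M[K]_3) (a : 'rV[L]_3).
Hypotheses (kA : forall i j, k i j ~> A i j) (A_unit : A \in unitmx).
Hypotheses (a_neq0 : forall i, a 0 i != 0) (a_int : \prod_i a 0 i \in O)
  (aV_int : (\prod_i a 0 i)^-1 \in O) (a_nint : ~ forall i, a 0 i \in O).

(** The coefficients of the reduction of a form are, on its support, the
    residues of units; integrality of the dilated coefficients is thus
    integrality of the monomials in [a]. *)
Lemma destabilizedP b (q : form) (c : 'X_{1..3} -> L) :
  (forall m, c m ~> (subst A q)@_m) ->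
  (forall m, if b then c m * mmap1 (a 0) m \in O else c m * mmap1 (a 0) m \in max_ideal S) ->
  destabilized b q.
Proof.
move=> cA ca.
have [|n [n0 ni nw]] := torus_weights (b := b) (s := msupp (subst A q))
    Sp a_neq0 a_int aV_int a_nint; last by exists A, n.
move=> m; rewrite mcoeff_msupp => qm.
have cV : (c m)^-1 \in O.
  have cmV := residue_neq0V Sp (cA m) qm.
  by apply/(@integralP _ _ S); exists ((subst A q)@_m)^-1.
have c0 : c m != 0.
  apply: contra_neq qm => c0; apply: Sp.1.2; rewrite -c0; exact: cA.
have -> : mmap1 (a 0) m = c m * mmap1 (a 0) m / c m by rewrite mulrAC divff ?mul1r.
by move: (ca m); case: (b) => cm; [rewrite rpredM|exact: max_idealM].
Qed.

(** [F1] and [F2] are the coefficients of two integral forms with reductions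
    [f1] and [f2] in the coordinates [A]; [U] and [V] are those after the
    dilation by [a]. *)
Section TwoForms.
Variables (f1 f2 : form) (F1 F2 U V : 'X_{1..3} -> L).
Hypotheses (F1res : forall m, F1 m ~> (subst A f1)@_m)
  (F2res : forall m, F2 m ~> (subst A f2)@_m)
  (UE : forall m, U m = F1 m * mmap1 (a 0) m)
  (VE : forall m, V m = F2 m * mmap1 (a 0) m)
  (minors : forall m m', U m * V m' - U m' * V m \in O).

(** Subtract from the first form the multiple [o] of the second one that kills
    the coefficient at [m0].  The minors at [m0] then read
    [(U m - o * V m) * V m0].  The difference reduces to the member
    [f1 - c *: f2], which is not destabilized, so some [U m - o * V m] has an
    integral inverse and the pivot [V m0] is integral. *)
Lemma pivot_integral m0 :
  (forall c, ~ destabilized false (f1 - c *: f2)) ->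
  (forall m, exists2 o, o \in O & U m = o * V m0) ->
  (forall m, exists2 o, o \in O & V m = o * V m0) ->
  forall m, U m \in O /\ V m \in O.
Proof.
move=> nd divU divV; have [o oi oE] := divU m0.
suff e_int : V m0 \in O.
  move=> m; have [o1 o1i ->] := divU m; have [o2 o2i ->] := divV m.
  by rewrite !rpredM.
have /(@integralP _ _ S)[c oc] := oi.
have uE m : (U m - o * V m) * V m0 \in O.
  have -> : (U m - o * V m) * V m0 = U m * V m0 - U m0 * V m by rewrite oE; ring.
  exact: minors.
have [m1 um1] : exists m, U m - o * V m \notin max_ideal S.
  apply: contrapT => nom; apply: (nd c).
  apply: (@destabilizedP _ _ (fun m => F1 m - o * F2 m)) => m /=.
    rewrite rmorphB /= mcoeffB substZ mcoeffZ.
    exact: (rpredB (F1res m) (rpredM oc (F2res m))).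
  apply: contrapT => /negP um; apply: nom; exists m.
  by rewrite UE VE mulrA -mulrBl.
have -> : V m0 = (U m1 - o * V m1) * V m0 / (U m1 - o * V m1).
  rewrite mulrAC divff ?mul1r //.
  by apply: contraNneq um1 => ->; exact: (rpred0 S).
by rewrite rpredM //; exact: max_idealN Sp _ um1.
Qed.

End TwoForms.

Lemma dilation_integral (f1 f2 : form) (F1 F2 U V : 'X_{1..3} -> L) (s : seq 'X_{1..3}) :
  (forall m, F1 m ~> (subst A f1)@_m) -> (forall m, F2 m ~> (subst A f2)@_m) ->
  (forall m, U m = F1 m * mmap1 (a 0) m) -> (forall m, V m = F2 m * mmap1 (a 0) m) ->
  (forall m m', U m * V m' - U m' * V m \in O) ->
  (forall m, m \notin s -> U m = 0) -> (forall m, m \notin s -> V m = 0) ->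
  (forall c, ~ destabilized false (f1 - c *: f2)) ->
  (forall c, ~ destabilized false (f2 - c *: f1)) ->
  forall m, U m \in O /\ V m \in O.
Proof.
move=> F1r F2r UE VE minO Us Vs nd12 nd21.
pose val (bm : bool * 'X_{1..3}) := if bm.1 then U bm.2 else V bm.2.
pose t := [seq (b, m) | b <- [:: true; false], m <- s].
have [t0|/(common_divisor Sp val)[[b m0] _ div]] := eqVneq t [::].
  move=> m; have ms : m \notin s.
    by apply/negP => ms; have : (true, m) \in t by [apply: allpairs_f]; rewrite t0.
  by rewrite Us // Vs // rpred0.
have {}div b' m : exists2 o, o \in O & val (b', m) = o * val (b, m0).
  have [ms|nm] := boolP (m \in s); first by apply: div; apply: allpairs_f => //; case: b'.
  by exists 0; rewrite ?rpred0 // mul0r /val; case: b'; [exact: Us|exact: Vs].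
case: b div => div m.
  apply/and_comm; apply: (pivot_integral F2r F1r VE UE _ nd21 (div false) (div true)).
  move=> m1 m2; rewrite -rpredN opprB mulrC [V m1 * _]mulrC; exact: minO.
exact: (pivot_integral F1r F2r UE VE minO nd12 (div true) (div false)).
Qed.

End PencilAtPole.

Lemma dilated_lincomb (R : comNzRingType) (O : subringClosed R) (b1 b2 x1 x2 y u1 u2 : R) :
  u1 = x1 * y -> u2 = x2 * y -> u1 \in O -> u2 \in O -> b1 \in O -> b2 \in O ->
  (b1 * x1 + b2 * x2) * y \in O.
Proof. by move=> -> -> u1O u2O b1O b2O; rewrite mulrDl -!mulrA rpredD // rpredM. Qed.

Section PencilStable.
Variables (K : numClosedFieldType) (d : nat).
Notation form := (ternary_form K d).

(** At a place with integral minors all the dilated coefficients of [f1] and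
    [f2] are integral, hence also those of a linear combination [q] of them. *)
Lemma destabilized_at_pole (L : fieldType) (iota : {rmorphism K -> L})
    (S : subringClosed (L * K)%type) (M : 'M[L]_3) (f1 f2 q : form) (c1 c2 : K) :
  place iota S -> \det M = 1 -> ~ integral_mx S M ->
  (forall m m', minor (subst M (map_mpoly iota (f1 : {mpoly K[3]})))
                      (subst M (map_mpoly iota (f2 : {mpoly K[3]}))) m m' \in integral S) ->
  (forall c, ~ destabilized false (f1 - c *: f2)) ->
  (forall c, ~ destabilized false (f2 - c *: f1)) ->
  q = c1 *: f1 + c2 *: f2 -> destabilized true q.
Proof.
move=> Sp dM nM minO nd12 nd21 qE.
have [k [l [a [ku lu ME]]]] := smith Sp M.
have [A A_unit kA] := residue_mx Sp ku.
have [k' [ki k'i] kk] := ku; have [l' [li l'i] ll] := lu.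
have dkk : \det k * \det k' = 1 by rewrite -det_mulmx kk det1.
have dll : \det l * \det l' = 1 by rewrite -det_mulmx ll det1.
have dkal : \det k * \prod_i a 0 i * \det l = 1 by move: dM; rewrite ME !det_mulmx det_diag.
have sandwich (x x' p y y' : L) : x * x' = 1 -> y * y' = 1 -> x * p * y = 1 ->
    p = x' * y' /\ p^-1 = x * y.
  move=> xx yy xpy; have pE : p = x' * y'.
    rewrite -[RHS]mul1r -xpy (_ : _ * _ * _ = (x * x') * p * (y * y')); last by ring.
    by rewrite xx yy mul1r mulr1.
  split=> //; have p0 : p != 0.
    by apply: contraTneq (oner_neq0 L) => p0; rewrite -xpy p0 mulr0 mul0r eqxx.
  by apply: (mulIf p0); rewrite mulVf // -xpy mulrAC.
have [aE aVE] := sandwich _ _ _ _ _ dkk dll dkal.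
have a_neq0 i : a 0 i != 0.
  apply: contraTneq (oner_neq0 L) => ai; rewrite -dkal (bigD1 i) //= ai.
  by rewrite mul0r mulr0 mul0r eqxx.
have a_nint : ~ forall i, a 0 i \in integral S.
  move=> ai; apply: nM; rewrite ME; apply: integral_mxM => //; apply: integral_mxM => //.
  by move=> i j; rewrite mxE rpredMn.
pose F (f : form) m := (subst k (map_mpoly iota (f : {mpoly K[3]})))@_m.
pose U (f : form) := subst (diag_mx a) (subst k (map_mpoly iota (f : {mpoly K[3]}))).
have Fr f m : (F f m, (subst A (f : {mpoly K[3]}))@_m) \in S.
  exact: (subst_coef_residue Sp (f : {mpoly K[3]}) m kA).
have UE f m : (U f)@_m = F f m * mmap1 (a 0) m by exact: subst_diag.
have Ul f : U f = subst l' (subst M (map_mpoly iota (f : {mpoly K[3]}))).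
  by rewrite /U !subst_comp ME -!mulmxA ll mulmx1.
have UminO m m' : (U f1)@_m * (U f2)@_m' - (U f1)@_m' * (U f2)@_m \in integral S.
  by rewrite !Ul; apply: (minor_subst Sp l'i minO).
have a_int : \prod_i a 0 i \in integral S by rewrite aE rpredM ?integral_det.
have aV_int : (\prod_i a 0 i)^-1 \in integral S by rewrite aVE rpredM ?integral_det.
have UO m : (U f1)@_m \in integral S /\ (U f2)@_m \in integral S.
  apply: (dilation_integral Sp A_unit a_neq0 a_int aV_int a_nint (Fr f1) (Fr f2)
    (UE f1) (UE f2) UminO (s := msupp (U f1) ++ msupp (U f2))) => //.
  - by move=> n; rewrite mem_cat => /norP[/memN_msupp_eq0].
  - by move=> n; rewrite mem_cat => /norP[_ /memN_msupp_eq0].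
apply: (destabilizedP Sp A_unit a_neq0 a_int aV_int a_nint (Fr q)).
move=> m /=; have -> : F q m = iota c1 * F f1 m + iota c2 * F f2 m.
  have qE' : (q : {mpoly K[3]}) = c1 *: (f1 : {mpoly K[3]}) + c2 *: (f2 : {mpoly K[3]}).
    by rewrite qE.
  rewrite /F qE' rmorphD rmorphD mcoeffD /=.
  rewrite (map_mpolyZ _ c1) (map_mpolyZ _ c2).
  rewrite (substZ _ (iota c1)) (substZ _ (iota c2)).
  by congr (_ + _); exact: mcoeffZ.
have [U1 U2] := UO m.
exact: (dilated_lincomb (UE f1 m) (UE f2 m) U1 U2 (integral_iota Sp c1) (integral_iota Sp c2)).
Qed.

(** The Hilbert-Mumford criterion for the Plücker vector, reduced to members of
    the pencil; up to scalars they are the [f1 - c *: f2] and the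
    [f2 - c *: f1]. *)
Theorem pencil_stable (f1 f2 q : form) (c1 c2 : K) :
  (forall c, ~ destabilized false (f1 - c *: f2)) ->
  (forall c, ~ destabilized false (f2 - c *: f1)) ->
  q = c1 *: f1 + c2 *: f2 -> ~ destabilized true q ->
  stable (@ext2_change K d) (wedge f1 f2).
Proof.
move=> nd12 nd21 qE ndq; apply: contrapT => nst; apply: ndq.
have [S [Sp Mint MN]] := not_stable_pole (ext2_change_regular f1 f2) nst.
apply: (destabilized_at_pole (M := generic_mx K 2) Sp (det_generic_mx K 2) Mint _ nd12 nd21 qE).
move=> m m'; have [psi /MN] := minor_pulls_back f1 f2 m m'.
suff -> : mx_eval (@const_frac K 2) (generic_mx K 2)
  (coefficient_poly (f1 : {mpoly K[3]}) m * coefficient_poly (f2 : {mpoly K[3]}) m' -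
   coefficient_poly (f1 : {mpoly K[3]}) m' * coefficient_poly (f2 : {mpoly K[3]}) m) =
  minor (subst (generic_mx K 2) (map_mpoly (@const_frac K 2) (f1 : {mpoly K[3]})))
        (subst (generic_mx K 2) (map_mpoly (@const_frac K 2) (f2 : {mpoly K[3]}))) m m' by [].
apply: etrans (rmorphB _ _ _) _; congr (_ - _);
  by apply: etrans (rmorphM _ _ _) _; congr (_ * _); exact: mx_eval_coef.
Qed.
End PencilStable.

(** * Pencils with at most two members that are not stable *)
Section Pencils.
Variables (K : numClosedFieldType) (d : nat).
Notation form := (ternary_form K d).

Lemma curve_eqP (f g : form) : f != 0 -> g != 0 -> g \in <[f]>%VS -> curve f = curve g.
Proof.
move=> f0 g0 gf; apply/esym/eqP; rewrite eqEdim -memvE gf /=.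
by rewrite !dim_vline f0 g0.
Qed.

Lemma sum_ord2 (V : nmodType) n (n2 : n = 2) (F : 'I_n -> V) (p0 : (0 < n)%N) (p1 : (1 < n)%N) :
  \sum_i F i = F (Ordinal p0) + F (Ordinal p1).
Proof.
subst n; rewrite !big_ord_recl big_ord0 addr0.
by congr (F _ + F _); apply: val_inj.
Qed.

Lemma bigmin_le_mem (s : seq int) x0 w : w \in s -> \big[Order.min/x0]_(v <- s) v <= w.
Proof.
elim: s => // v s IHs; rewrite inE big_cons => /predU1P[->|/IHs ws].
  by rewrite ge_min lexx.
by rewrite ge_min ws orbT.
Qed.

(** As the weights [a] have sum 0, the affine weight differs by [- d * a 2] from
    the least weight of a monomial, and the threshold [d / 3] corresponds to
    least weight 0. *)
Lemma nonstable_wrt_weight h a (q : form) m :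
  a 2 <= a 1 <= a 0 -> 0 < a 0 -> a 0 + a 1 + a 2 = 0 -> nonstable_wrt h a q ->
  m \in msupp (subst (invmx h) (q : {mpoly K[3]})) -> 0 <= weight a m.
Proof.
move=> a_le a0 asum; rewrite /nonstable_wrt /affine_weight => aw.
rewrite -lin_changeE => mq.
have := bigmin_le_mem
  (head 0 [seq monomial_weight a m | m <- msupp (lin_change h q : {mpoly K[3]})])
  (map_f (monomial_weight a) mq).
move: aw; set w := \big[_/_]_(_ <- _) _ => aw wm.
have a2 : a 2 < 0 by lia.
have wE : w = - d%:Z * a 2.
  have D : ((a 0 - a 2) + (a 1 - a 2)) != 0 by lia.
  move/eqP: aw; rewrite eqr_div ?intr_eq0 // -[3]/(3%:~R) -[d%:R]/(d%:Z%:~R) -!intrM.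
  have -> : a 0 - a 2 + (a 1 - a 2) = - a 2 * 3 by lia.
  by rewrite eqr_int mulrA mulrN -mulNr => /eqP/mulIf; apply.
have md : (m 0%R + m 1%R + m 2%R)%N = d.
  by rewrite -(mdeg_msupp mq) mdegE (@big_ord3 _ _ _ 0 1 2) //= addnA.
rewrite /weight (@big_ord3 _ _ _ 0 1 2) //=.
move: wm; rewrite wE /monomial_weight -md; lia.
Qed.

Section TwoSemistableMembers.
Variables (P : {vspace form}) (f g : form).
Hypotheses (fP : f \in P) (f_neq0 : f != 0) (gP : g \in P) (g_neq0 : g != 0)
  (fg : curve f != curve g)
  (f_ss : semistable_curve f) (g_ss : semistable_curve g)
  (others_stable : forall q : form, q \in P -> q != 0 ->
     curve q != curve f -> curve q != curve g -> stable_curve q).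

Lemma sum_stable : stable_curve (f + g).
Proof.
have gNf : g \notin <[f]>%VS by apply: contra fg => gf; apply/eqP/curve_eqP.
have fNg : f \notin <[g]>%VS.
  by apply: contra fg => gf; rewrite eq_sym; apply/eqP/curve_eqP.
apply: others_stable; first exact: memvD.
- by apply: contra gNf => /eqP fg0; rewrite -(addKr f g) fg0 addr0 memvN memv_line.
- apply: contra gNf => /eqP E; rewrite -(addKr f g) memvD ?memvN ?memv_line //.
  by rewrite -[<[f]>%VS]E memv_line.
apply: contra fNg => /eqP E; rewrite -(addrK g f) memvB ?memv_line //.
by rewrite -[<[g]>%VS]E memv_line.
Qed.

Lemma member_not_destabilized q : q \in P -> q != 0 -> ~ destabilized false q.
Proof.
move=> qP q0.
have mult u : semistable_curve u -> curve q = curve u -> ~ destabilized false q.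
  move=> us E.
  have /vlineP[c qE] : q \in <[u]>%VS by rewrite -[<[u]>%VS]E memv_line.
  rewrite qE => /destabilizedZ ndu.
  apply: (semistable_not_destabilized us); apply: ndu.
  by apply: contra_neq q0 => c0; rewrite qE c0 scale0r.
have [/mult|qf] := eqVneq (curve q) (curve f); first exact.
have [/mult|qg] := eqVneq (curve q) (curve g); first exact.
by move=> /destabilized_weaken; apply/stable_not_destabilized/others_stable.
Qed.

Lemma plucker_stable : pencil P -> stable (@ext2_change K d) (plucker P).
Proof.
move=> dimP; have p0 : (0 < \dim P)%N by rewrite dimP.
have p1 : (1 < \dim P)%N by rewrite dimP.
pose b := vbasis P; have bfree := basis_free (vbasisP P).
have bP i : (i < \dim P)%N -> b`_i \in P.
  by move=> i_lt; apply: vbasis_mem; rewrite mem_nth ?size_tuple.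
have coordb (i j : 'I_(\dim P)) : coord b j b`_i = (j == i)%:R.
  by rewrite coord_free // eq_sym.
have indep (i j : 'I_(\dim P)) c : i != j -> b`_i - c *: b`_j != 0.
  move=> ij; apply/eqP => /(congr1 (coord b i)).
  rewrite linearB linearZ /= !coordb eqxx (negPf ij) mulr0 subr0 linear0.
  by move/eqP; rewrite oner_eq0.
apply: (@pencil_stable K d b`_0 b`_1 (f + g) (coord b (Ordinal p0) (f + g))
  (coord b (Ordinal p1) (f + g))).
- move=> c; apply: member_not_destabilized; first by rewrite memvB ?memvZ ?bP.
  exact: (indep (Ordinal p0) (Ordinal p1)).
- move=> c; apply: member_not_destabilized; first by rewrite memvB ?memvZ ?bP.
  exact: (indep (Ordinal p1) (Ordinal p0)).
- by rewrite {1}(coord_vbasis (memvD fP gP)) (sum_ord2 dimP _ p0 p1).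
exact/stable_not_destabilized/sum_stable.
Qed.

End TwoSemistableMembers.

End Pencils.

Theorem theorem1p6 (R : realType) (d : nat) (hd : (1 <= d)%N)
    (P : {vspace ternary_form R[i] d}) (hP : pencil P)
    (f g : ternary_form R[i] d)
    (hfP : f \in P) (hf0 : f != 0) (hgP : g \in P) (hg0 : g != 0)
    (hfg : curve f != curve g)
    (hf : semistable_curve f) (hg : semistable_curve g)
    (hst : forall q : ternary_form R[i] d, q \in P -> q != 0 ->
       curve q != curve f -> curve q != curve g -> stable_curve q) :
  strictly_semistable_pencil P <->
  exists (lam : R[i] -> 'M[R[i]]_3) (h : 'M[R[i]]_3) (a : 'I_3 -> int),
    [/\ one_parameter_subgroup lam, h \in unitmx, normalized lam h a,
        nonstable_wrt h a f & nonstable_wrt h a g].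
Proof.
split=> [[_ nst]|].
  by case: nst; exact: (plucker_stable hfP hf0 hgP hg0 hfg hf hg hst hP).
move=> [lam [h [a [_ hu [a_le a0 asum _] nf ng]]]].
have fg_stable := sum_stable hfP hf0 hgP hg0 hfg hst.
case: (stable_not_destabilized fg_stable); exists (invmx h), a; split.
- by rewrite unitmx_inv.
- by rewrite (@big_ord3 _ _ _ 0 1 2) //= addrA.
- by exists 0; rewrite gt_eqF.
move=> m mfg /=.
have [mf|mf] := boolP (m \in msupp (subst (invmx h) (f : {mpoly R[i][3]}))).
  exact: nonstable_wrt_weight a_le a0 asum nf mf.
apply: nonstable_wrt_weight a_le a0 asum ng _; apply: contraLR mfg => mg.
rewrite mcoeff_msupp negbK.
rewrite (_ : ((f + g : ternary_form R[i] d) : {mpoly R[i][3]}) =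
  (f : {mpoly R[i][3]}) + (g : {mpoly R[i][3]})) // rmorphD /= mcoeffD.
by rewrite (memN_msupp_eq0 mf) (memN_msupp_eq0 mg) addr0.
Qed.
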